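(* Let $A$ be a bounded unital $*$-algebra over $\mathbb{C}$ that has no non-trivial $*$-ideal which is both endomorphically closed and square root closed. Then $A$ is $C^*$-representable if and only if $A$ is completely positive.
   Context: For a unital $*$-algebra $A$ with unit $e$, $A_{sa}$ is the set of self-adjoint elements and $A_+=\{\sum_{i=1}^n a_i^*a_i : n\ge 1,\ a_i\in A\}$. For $a,b\in A_{sa}$ write $a\ge b$ if $a-b\in A_+$. An element $a\in A_{sa}$ is bounded if $\alpha e\ge a\ge-\alpha e$ for some real $\alpha\ge 0$; $x=a+ib$ with $a,b\in A_{sa}$ is bounded if $a$ and $b$ are; $A$ is bounded if all its elements are bounded. An ideal $I$ of $A$ is endomorphically closed if $f(I)\subseteq I$ for every $*$-endomorphism $f:A\to A$. A $*$-ideal $J$ of $A$ is square root closed if for all $x_1,\dots,x_n\in A$, $\sum_{j=1}^n x_jx_j^*\in J$ implies $x_j\in J$ for all $j$. The trivial ideals are $\{0\}$ and $A$. A $*$-algebra $B$ is positive if $x^*x=0$ with $x\in B$ implies $x=0$. $A$ is completely positive if $M_n(A)$ is positive for every $n\ge1$. $A$ is $C^*$-representable if it is $*$-isomorphic to a $*$-subalgebra of a $C^*$-algebra. *)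

(* Defs.v *)
From HB Require Import structures.
From mathcomp Require Import all_boot all_order all_algebra.
From mathcomp Require Import all_classical all_reals all_analysis.
From mathcomp Require Import complex.

Set Implicit Arguments.
Unset Strict Implicit.
Unset Printing Implicit Defensive.

Import Order.TTheory GRing.Theory Num.Theory.
Import numFieldNormedType.Exports.

Local Open Scope classical_set_scope.
Local Open Scope ring_scope.
Local Open Scope complex_scope.

Reserved Notation "x ** y" (at level 40, left associativity).

(* The complex field is R[i] with R : realType.

   The ring structures of MathComp carry a unit, and algType moreover imposes
   1 != 0. The *-algebras below are therefore modules with their own product,
   so that one hierarchy covers non-unital C*-algebras and the zero algebra. *)
HB.mixin Record Lmodule_isStarAlgebra (C : numClosedFieldType) A
    of GRing.Lmodule C A := {
  smul : A -> A -> A;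
  star : A -> A;
  smulA : associative smul;
  smulDl : forall x y z : A, smul (x + y) z = smul x z + smul y z;
  smulDr : forall x y z : A, smul x (y + z) = smul x y + smul x z;
  smulZl : forall (c : C) (x y : A), smul (c *: x) y = c *: smul x y;
  smulZr : forall (c : C) (x y : A), smul x (c *: y) = c *: smul x y;
  starK : involutive star;
  starD : {morph star : x y / x + y};
  starZ : forall (c : C) (x : A), star (c *: x) = Num.conj c *: star x;
  starM : forall x y, star (smul x y) = smul (star y) (star x)
}.

#[short(type="starAlgType")]
HB.structure Definition StarAlgebra (C : numClosedFieldType) :=
  {A of GRing.Lmodule C A & Lmodule_isStarAlgebra C A}.

Notation "x ** y" := (smul x y) : ring_scope.

HB.mixin Record StarAlgebra_isUnital (C : numClosedFieldType) A
    of StarAlgebra C A := {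
  sone : A;
  smul1x : left_id sone smul;
  smulx1 : right_id sone smul
}.

#[short(type="unitalStarAlgType")]
HB.structure Definition UnitalStarAlgebra (C : numClosedFieldType) :=
  {A of StarAlgebra C A & StarAlgebra_isUnital C A}.

HB.mixin Record StarAlgebra_isCStar (C : numClosedFieldType) B
    of StarAlgebra C B & CompleteNormedModule C B := {
  ler_norm_smul : forall x y : B, `|x ** y| <= `|x| * `|y|;
  norm_star_smul : forall x : B, `|star x ** x| = `|x| ^+ 2
}.

#[short(type="cstarAlgType")]
HB.structure Definition CStarAlgebra (C : numClosedFieldType) :=
  {B of StarAlgebra C B & CompleteNormedModule C B & StarAlgebra_isCStar C B}.

(* The alias is needed because 'M[A]_n is canonically a module over its ring of
   entries, not over C. *)
Definition star_matrix (C : numClosedFieldType) (A : starAlgType C) (n : nat) :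
  Type := 'M[A]_n.

Section StarMatrix.
Variables (C : numClosedFieldType) (A : starAlgType C) (n : nat).
Local Notation M_n := (star_matrix A n).
Implicit Types M N P : M_n.

HB.instance Definition _ := GRing.Zmodule.copy M_n 'M[A]_n.

Definition mx_scale (c : C) M : M_n := \matrix_(i, j) (c *: M i j).
Definition mx_smul M N : M_n := \matrix_(i, j) \sum_(k < n) (M i k ** N k j).
Definition mx_star M : M_n := \matrix_(i, j) star (M j i).

Fact mx_scaleA c d M : mx_scale c (mx_scale d M) = mx_scale (c * d) M.
Proof. by apply/matrixP=> i j; rewrite !mxE scalerA. Qed.

Fact mx_scale1 : left_id 1 mx_scale.
Proof. by move=> M; apply/matrixP=> i j; rewrite !mxE scale1r. Qed.

Fact mx_scaleDr : right_distributive mx_scale +%R.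
Proof. by move=> c M N; apply/matrixP=> i j; rewrite !mxE scalerDr. Qed.

Fact mx_scaleDl M : {morph mx_scale^~ M : c d / c + d}.
Proof.
by move=> c d; apply/matrixP=> i j; rewrite !mxE scalerDl.
Qed.

HB.instance Definition _ := GRing.Zmodule_isLmodule.Build C M_n
  mx_scaleA mx_scale1 mx_scaleDr mx_scaleDl.

Let smul0x (x : A) : 0 ** x = 0.
Proof. by rewrite -[X in X ** _](scale0r x) smulZl scale0r. Qed.

Let smulx0 (x : A) : x ** 0 = 0.
Proof. by rewrite -[X in _ ** X](scale0r x) smulZr scale0r. Qed.

Let star0 : star (0 : A) = 0.
Proof. by apply: (addIr (star 0)); rewrite -starD !add0r. Qed.

Fact mx_smulA : associative mx_smul.
Proof.
move=> M N P; apply/matrixP=> i j; rewrite !mxE.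
under eq_bigr => k _ do
  rewrite mxE (big_morph _ (smulDr (M i k)) (smulx0 (M i k))).
rewrite exchange_big /=; apply: eq_bigr => l _.
rewrite mxE (big_morph (smul^~ (P l j)) (fun x y => smulDl x y (P l j))
  (smul0x (P l j))).
by apply: eq_bigr => k _; rewrite smulA.
Qed.

Fact mx_smulDl M N P : mx_smul (M + N) P = mx_smul M P + mx_smul N P.
Proof.
apply/matrixP=> i j; rewrite !mxE -big_split.
by apply: eq_bigr => k _; rewrite !mxE smulDl.
Qed.

Fact mx_smulDr M N P : mx_smul M (N + P) = mx_smul M N + mx_smul M P.
Proof.
apply/matrixP=> i j; rewrite !mxE -big_split.
by apply: eq_bigr => k _; rewrite !mxE smulDr.
Qed.

Fact mx_smulZl (c : C) M N : mx_smul (c *: M) N = c *: mx_smul M N.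
Proof.
apply/matrixP=> i j; rewrite !mxE scaler_sumr.
by apply: eq_bigr => k _; rewrite !mxE smulZl.
Qed.

Fact mx_smulZr (c : C) M N : mx_smul M (c *: N) = c *: mx_smul M N.
Proof.
apply/matrixP=> i j; rewrite !mxE scaler_sumr.
by apply: eq_bigr => k _; rewrite !mxE smulZr.
Qed.

Fact mx_starK : involutive mx_star.
Proof. by move=> M; apply/matrixP=> i j; rewrite !mxE starK. Qed.

Fact mx_starD : {morph mx_star : M N / M + N}.
Proof. by move=> M N; apply/matrixP=> i j; rewrite !mxE starD. Qed.

Fact mx_starZ (c : C) M : mx_star (c *: M) = Num.conj c *: mx_star M.
Proof. by apply/matrixP=> i j; rewrite !mxE starZ. Qed.

Fact mx_starM M N : mx_star (mx_smul M N) = mx_smul (mx_star N) (mx_star M).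
Proof.
apply/matrixP=> i j; rewrite !mxE (big_morph _ (@starD _ A) star0).
by apply: eq_bigr => k _; rewrite !mxE starM.
Qed.

HB.instance Definition _ := Lmodule_isStarAlgebra.Build C M_n
  mx_smulA mx_smulDl mx_smulDr mx_smulZl mx_smulZr
  mx_starK mx_starD mx_starZ mx_starM.

End StarMatrix.

Section Notions.
Variable C : numClosedFieldType.

Definition positive (B : starAlgType C) : Prop :=
  forall x : B, star x ** x = 0 -> x = 0.

Definition completely_positive (A : starAlgType C) : Prop :=
  forall n : nat, (1 <= n)%N -> positive (star_matrix A n).

(* *-homomorphisms, hence *-endomorphisms, need not preserve a unit. *)
Definition star_homomorphism (A B : starAlgType C) (f : A -> B) : Prop :=
  [/\ linear f, {morph f : x y / x ** y} & {morph f : x / star x}].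

(* Purely algebraic: no norm closedness is required in a C*-algebra. *)
Definition star_subalgebra (B : starAlgType C) (S : set B) : Prop :=
  [/\ S 0,
      forall (c : C) x y, S x -> S y -> S (c *: x + y),
      forall x y, S x -> S y -> S (x ** y)
    & forall x, S x -> S (star x)].

Definition cstar_representable (A : starAlgType C) : Prop :=
  exists (B : cstarAlgType C) (S : set B) (phi : A -> B),
    [/\ star_subalgebra S, star_homomorphism phi & set_bij [set: A] S phi].

Definition star_ideal (A : starAlgType C) (J : set A) : Prop :=
  [/\ J 0,
      forall (c : C) x y, J x -> J y -> J (c *: x + y),
      forall a x, J x -> J (a ** x) /\ J (x ** a)
    & forall x, J x -> J (star x)].

Definition endomorphically_closed (A : starAlgType C) (J : set A) : Prop :=
  forall f : A -> A, star_homomorphism f -> f @` J `<=` J.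

Definition square_root_closed (A : starAlgType C) (J : set A) : Prop :=
  forall n (x : 'I_n -> A),
    J (\sum_(j < n) x j ** star (x j)) -> forall j, J (x j).

Definition trivial_ideal (A : starAlgType C) (J : set A) : Prop :=
  J = [set 0] \/ J = [set: A].

End Notions.

Section Boundedness.
Variables (R : realType) (A : unitalStarAlgType R[i]).
Local Notation e := (sone : A).

Definition self_adjoint (a : A) : Prop := star a = a.

Definition pos_cone : set A :=
  [set a | exists n (x : 'I_n -> A),
     (1 <= n)%N /\ a = \sum_(j < n) star (x j) ** x j].

Definition star_ge (a b : A) : Prop := pos_cone (a - b).

Definition bounded_sa (a : A) : Prop :=
  exists alpha : R, [/\ 0 <= alpha, star_ge (alpha%:C *: e) a
                      & star_ge a (- (alpha%:C *: e))].

Definition bounded_elt (x : A) : Prop :=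
  exists a b : A, [/\ self_adjoint a, self_adjoint b, x = a + 'i *: b,
                      bounded_sa a & bounded_sa b].

Definition bounded_star_algebra : Prop := forall x : A, bounded_elt x.

End Boundedness.

Arguments bounded_star_algebra {R} A.

(* Main.v *)
From HB Require Import structures.
Require Import Defs.
From mathcomp Require Import all_boot all_order all_algebra.
From mathcomp Require Import all_classical all_reals all_analysis.
From mathcomp Require Import complex.
From mathcomp Require Import generic_quotient ring lra.

(** The bridge between the two conditions is the existence of a C*-norm, a
    real-valued norm N with N (x y) <= N x * N y and N (x^* x) = (N x)^2:
    A is C*-representable exactly when it carries one
    ([cstar_representableP]).  A representation pulls the norm of the
    C*-algebra back to A; conversely, the completion of A for a C*-norm is a
    C*-algebra, and A embeds in it isometrically.

    Representable implies completely positive.  If M^* M = 0 for a matrix M,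
    its diagonal entries say that, for each j, the sum over k of
    (M k j)^* (M k j) is 0, so it suffices that in a complete unital C*-normed
    algebra elements x^* x have no non-trivial vanishing sum
    ([sum_star_mul_eq0]).  This is the theorem that x^* x is positive
    ([nonneg_star_mul]), proved here without spectral theory.  An element a
    is called nonnegative when it is self-adjoint and N (t - a) <= t for some
    t > 0; such elements visibly form a convex cone.  A monotone iteration
    gives them square roots that commute with everything commuting with them
    ([nonneg_sqrt]).  Square roots yield unitaries r + i b, which show that
    squares of self-adjoint elements are nonnegative ([nonneg_square]) and
    that the cone contains no line ([nonneg_antisym]).  For h = x^* x and
    v = |h| - h, the element y = x v satisfies y^* y = - c^2 with c
    self-adjoint, which forces y = 0, then v = 0, so that h = |h|.

    Completely positive implies representable.  Let N x be the infimum of the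
    r > 0 for which r^2 e - x^* x is a sum of elements a^* a.  Boundedness
    makes N finite, and purely algebraic identities show that it is a
    C*-seminorm.  Its kernel is a *-ideal that is endomorphically closed and
    square root closed, hence is {0} or A.  If it is A, then -e is a sum of
    elements a^* a; the column (e, a_1, ..., a_n) is then annihilated by its
    adjoint, and positivity of the matrices of order n + 1 gives e = 0
    ([completely_positive_proper]), so that A = {0}.  The kernel is {0} in
    both cases, and N is a C*-norm. *)

Set Implicit Arguments.
Unset Strict Implicit.
Unset Printing Implicit Defensive.

Import Order.TTheory GRing.Theory Num.Theory.
Import numFieldNormedType.Exports.

Local Open Scope classical_set_scope.
Local Open Scope ring_scope.
Local Open Scope complex_scope.

(** * Linear identities in a module *)

Section SquareZeroExtension.
Variables (K : comNzRingType) (V : lmodType K).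

(** The commutative ring K + V in which V squares to zero.  A linear identity
    in V is an identity of commutative polynomials there, so it is decided by
    the ring normalizer. *)
Definition sqzero : Type := (K * V)%type.

HB.instance Definition _ := GRing.Zmodule.copy sqzero (K * V)%type.

Definition sqzero_mul (x y : sqzero) : sqzero :=
  (x.1 * y.1, x.1 *: y.2 + y.1 *: x.2).

Fact sqzero_mulA : associative sqzero_mul.
Proof.
move=> [a u] [b v] [c w]; rewrite /sqzero_mul /= mulrA !scalerDr !scalerA.
by rewrite addrA [c * a]mulrC [c * b]mulrC.
Qed.

Fact sqzero_mulC : commutative sqzero_mul.
Proof. by move=> x y; rewrite /sqzero_mul mulrC addrC. Qed.

Fact sqzero_mul1 : left_id (1, 0) sqzero_mul.
Proof. by case=> a u; rewrite /sqzero_mul /= mul1r scale1r scaler0 addr0. Qed.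

Fact sqzero_mulDl : left_distributive sqzero_mul +%R.
Proof.
move=> [a u] [b v] [c w]; congr (_, _) => /=; first by rewrite mulrDl.
by rewrite scalerDl scalerDr addrACA.
Qed.

Fact sqzero_1neq0 : ((1, 0) : sqzero) != 0.
Proof. by apply/eqP => -[/eqP]; rewrite oner_eq0. Qed.

HB.instance Definition _ := GRing.Zmodule_isComNzRing.Build sqzero
  sqzero_mulA sqzero_mulC sqzero_mul1 sqzero_mulDl sqzero_1neq0.

Definition sqzero_scalar (c : K) : sqzero := (c, 0).
Definition sqzero_vec (v : V) : sqzero := (0, v).

Fact sqzero_scalar_is_nmod_morphism : nmod_morphism sqzero_scalar.
Proof. by split=> // a b; congr (_, _); rewrite /= addr0. Qed.

Fact sqzero_scalar_is_monoid_morphism : monoid_morphism sqzero_scalar.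
Proof. by split=> // a b; congr (_, _); rewrite /= !scaler0 addr0. Qed.

HB.instance Definition _ := GRing.isNmodMorphism.Build K sqzero sqzero_scalar
  sqzero_scalar_is_nmod_morphism.
HB.instance Definition _ := GRing.isMonoidMorphism.Build K sqzero sqzero_scalar
  sqzero_scalar_is_monoid_morphism.

Lemma sqzero_vec0 : sqzero_vec 0 = 0. Proof. by []. Qed.

Lemma sqzero_vecD u v : sqzero_vec (u + v) = sqzero_vec u + sqzero_vec v.
Proof. by congr (_, _); rewrite /= addr0. Qed.

Lemma sqzero_vecN v : sqzero_vec (- v) = - sqzero_vec v.
Proof. by congr (_, _); rewrite /= oppr0. Qed.

Lemma sqzero_vecZ c v : sqzero_vec (c *: v) = sqzero_scalar c * sqzero_vec v.
Proof. by congr (_, _); rewrite /= ?mulr0 // scale0r addr0. Qed.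

Lemma sqzero_vec_inj : injective sqzero_vec.
Proof. by move=> u v []. Qed.

End SquareZeroExtension.

Ltac linear_identity :=
  apply: sqzero_vec_inj;
  rewrite ?(sqzero_vecD, sqzero_vecN, sqzero_vec0, sqzero_vecZ); ring.

(** * Star-algebras *)

Section StarAlgebraTheory.
Variables (C : numClosedFieldType) (A : starAlgType C).
Implicit Types x y z : A.

Lemma smul0x x : 0 ** x = 0.
Proof. by rewrite -[X in X ** _](scale0r x) smulZl scale0r. Qed.

Lemma smulx0 x : x ** 0 = 0.
Proof. by rewrite -[X in _ ** X](scale0r x) smulZr scale0r. Qed.

Lemma smulNl x y : (- x) ** y = - (x ** y).
Proof. by rewrite -scaleN1r smulZl scaleN1r. Qed.

Lemma smulNr x y : x ** (- y) = - (x ** y).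
Proof. by rewrite -scaleN1r smulZr scaleN1r. Qed.

Lemma star0 : star (0 : A) = 0.
Proof. by apply: (addIr (star 0)); rewrite -starD !add0r. Qed.

Lemma starN x : star (- x) = - star x.
Proof. by apply/eqP; rewrite -addr_eq0 -starD addNr star0. Qed.

Definition smulE := (@smulDl C A, @smulDr C A, smulNl, smulNr, @smulZl C A,
  @smulZr C A).
Definition starE := (@starD C A, starN, @starZ C A, @starM C A).

Lemma star_sum I (r : seq I) (F : I -> A) :
  star (\sum_(i <- r) F i) = \sum_(i <- r) star (F i).
Proof. exact: (big_morph _ (@starD C A) star0). Qed.

Lemma smul_suml I (r : seq I) (F : I -> A) x :
  (\sum_(i <- r) F i) ** x = \sum_(i <- r) F i ** x.
Proof.
exact: (big_morph (smul^~ x) (fun a b => smulDl a b x) (smul0x x)).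
Qed.

Lemma smul_sumr I (r : seq I) (F : I -> A) x :
  x ** (\sum_(i <- r) F i) = \sum_(i <- r) x ** F i.
Proof. exact: (big_morph _ (smulDr x) (smulx0 x)). Qed.

Definition commute x y := x ** y = y ** x.

End StarAlgebraTheory.

Section StarHomomorphism.
Variables (C : numClosedFieldType) (A B : starAlgType C) (f : A -> B).
Hypothesis f_hom : star_homomorphism f.

Lemma star_homD : {morph f : x y / x + y}.
Proof. by case: f_hom => lin _ _ x y; have := lin 1 x y; rewrite !scale1r. Qed.

Lemma star_hom0 : f 0 = 0.
Proof. by apply: (addIr (f 0)); rewrite -star_homD !add0r. Qed.

Lemma star_homZ c x : f (c *: x) = c *: f x.
Proof.
by case: f_hom => lin _ _; rewrite -[c *: x]addr0 lin star_hom0 addr0.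
Qed.

Lemma star_homB : {morph f : x y / x - y}.
Proof. by move=> x y; rewrite -scaleN1r star_homD star_homZ scaleN1r. Qed.

Lemma star_hom_range_subalgebra : star_subalgebra (range f).
Proof.
case: f_hom => lin mul st; split.
- by exists 0 => //; exact: star_hom0.
- by move=> c _ _ [x _ <-] [y _ <-]; exists (c *: x + y) => //; exact: lin.
- by move=> _ _ [x _ <-] [y _ <-]; exists (x ** y) => //; exact: mul.
- by move=> _ [x _ <-]; exists (star x) => //; exact: st.
Qed.

End StarHomomorphism.

Lemma star_one (C : numClosedFieldType) (A : unitalStarAlgType C) :
  star (sone : A) = sone.
Proof. by rewrite -[RHS]starK -[star sone in RHS]smul1x starM starK smul1x. Qed.

Section ComplexModulus.
Variable R : realType.

Lemma conj_real (r : R) : Num.conj r%:C = r%:C.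
Proof. by apply/CrealP; rewrite complex_real. Qed.

(** The order of R[i] makes norms complex numbers; analysis is done with their
    real parts. *)
Definition modulus (c : R[i]) : R := complex.Re `|c|.

Lemma modulusE c : (modulus c)%:C = `|c|.
Proof. by rewrite /modulus RRe_real // normr_real. Qed.

Lemma modulus_ge0 c : 0 <= modulus c.
Proof. by rewrite -ler0c modulusE. Qed.

Lemma modulus_real (r : R) : modulus r%:C = `|r|.
Proof.
by rewrite /modulus normc_def /= expr0n addr0 sqrtr_sqr.
Qed.

Lemma modulus0 : modulus 0 = 0.
Proof. by apply: complexI; rewrite modulusE normr0. Qed.

Lemma modulusN1 : modulus (-1) = 1.
Proof. by apply: complexI; rewrite modulusE normrN1. Qed.

Lemma modulusi : modulus 'i = 1.
Proof. by apply: complexI; rewrite modulusE normCi. Qed.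

End ComplexModulus.

(** * Estimates over the reals *)

Lemma inv_nat_small (R : realType) (eps : R) : 0 < eps ->
  exists K, forall k, (K <= k)%N -> k.+1%:R^-1 <= eps.
Proof.
move=> eps0; have [K _ hK] := near_infty_natSinv_lt (PosNum eps0).
by exists K => k Kk; apply/ltW/hK.
Qed.

Lemma squeeze0 (R : realType) (f g : nat -> R) : (forall n, 0 <= f n <= g n) ->
  g @ \oo --> (0 : R) -> f @ \oo --> (0 : R).
Proof.
move=> fg g0; apply: (squeeze_cvgr _ (cvg_cst 0) g0).
by near=> n; exact: fg.
Unshelve. all: by end_near.
Qed.

Lemma squeeze0D (R : realType) (f g h : nat -> R) :
  (forall n, 0 <= f n <= g n + h n) ->
  g @ \oo --> (0 : R) -> h @ \oo --> (0 : R) -> f @ \oo --> (0 : R).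
Proof.
by move=> fgh g0 h0; apply: (squeeze0 fgh); rewrite -[0]addr0; exact: cvgD.
Qed.

Lemma le_mul_of_gt (R : realType) (a b c : R) : 0 <= c ->
  (forall r, a < r -> b <= r * c) -> b <= a * c.
Proof.
move=> c0 h; apply/ler_addgt0Pr => eps eps0.
have c1 : 0 < c + 1 by lra.
have := h (a + eps / (c + 1)); rewrite ltrDl divr_gt0 // => /(_ isT).
move/le_trans; apply; rewrite mulrDl lerD2l mulrAC ler_pdivrMr //; nra.
Qed.

(** * C*-norms and convergence *)

Section CStarNorms.
Variables (R : realType) (A : starAlgType R[i]).

Record cstar_norm (N : A -> R) : Prop := CStarNorm {
  cnorm_eq0 : forall x, N x = 0 -> x = 0;
  cnormD : forall x y, N (x + y) <= N x + N y;
  cnormZ : forall c x, N (c *: x) = modulus c * N x;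
  cnormM : forall x y, N (x ** y) <= N x * N y;
  cnorm_star_mul : forall x, N (star x ** x) = N x ^+ 2
}.

Definition cauchy_for (N : A -> R) (u : nat -> A) :=
  forall eps, 0 < eps ->
    exists K, forall m n, (K <= m)%N -> (K <= n)%N -> N (u m - u n) <= eps.

(** Convergence for the distance N (x - y), stated in R because the algebra
    carries no topology of its own at this point. *)
Definition tends_to (N : A -> R) (u : nat -> A) (l : A) :=
  (fun n => N (u n - l)) @ \oo --> (0 : R).

Definition complete_for (N : A -> R) :=
  forall u, cauchy_for N u -> exists l, tends_to N u l.

Variables (N : A -> R) (hN : cstar_norm N).
Implicit Types (x y z : A) (u v : nat -> A).

Lemma cnorm0 : N 0 = 0.
Proof. by rewrite -(scale0r 0) (cnormZ hN) modulus0 mul0r. Qed.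

Lemma cnormN x : N (- x) = N x.
Proof.
by rewrite -scaleN1r (cnormZ hN) modulusN1 mul1r.
Qed.

Lemma cnorm_ge0 x : 0 <= N x.
Proof.
have := cnormD hN x (- x); rewrite subrr cnorm0 cnormN => h; lra.
Qed.

Lemma cnormB x y : N (x - y) = N (y - x).
Proof. by rewrite -cnormN opprB. Qed.

(** The C*-identity and submultiplicativity give N x ^ 2 <= N (x^* ) * N x;
    cancel N x, and apply the resulting inequality to x^* as well. *)
Lemma cnorm_star x : N (star x) = N x.
Proof.
have le_star y : N y <= N (star y).
  have := cnormM hN (star y) y; rewrite (cnorm_star_mul hN) expr2.
  have [->|y0] := eqVneq (N y) 0; first by rewrite cnorm_ge0.
  by rewrite ler_pM2r // lt_def y0 cnorm_ge0.
by apply/eqP; rewrite eq_le le_star -{2}[x]starK le_star.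
Qed.

Lemma cnorm_real r x : N (r%:C *: x) = `|r| * N x.
Proof. by rewrite (cnormZ hN) modulus_real. Qed.

Lemma cnorm_triangle z x y : N (x - y) <= N (x - z) + N (z - y).
Proof. by have := cnormD hN (x - z) (z - y); rewrite addrA subrK. Qed.

Lemma cnorm_dist x y : `|N x - N y| <= N (x - y).
Proof.
rewrite ler_norml; apply/andP; split.
  have := cnorm_triangle x y 0; rewrite !subr0 => h.
  by rewrite cnormB; lra.
by have := cnorm_triangle y x 0; rewrite !subr0 => h; lra.
Qed.

Lemma star_mul_eq0 x : star x ** x = 0 -> x = 0.
Proof.
move=> xx0; apply: (cnorm_eq0 hN).
by apply/eqP; rewrite -sqrf_eq0 -(cnorm_star_mul hN) xx0 cnorm0.
Qed.

Lemma tends_to_unique u l l' : tends_to N u l -> tends_to N u l' -> l = l'.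
Proof.
move=> ul ul'; apply/eqP; rewrite -subr_eq0; apply/eqP/(cnorm_eq0 hN).
have h0 : (fun n : nat => N (u n - l) + N (u n - l')) @ \oo --> (0 : R).
  by rewrite -[0]addr0; exact: cvgD.
have hc : (fun=> N (l - l')) @ \oo --> (0 : R).
  apply: (squeeze0 _ h0) => n.
  by rewrite cnorm_ge0 (cnormB (u n) l) cnorm_triangle.
exact: (cvg_unique _ (cvg_cst _) hc).
Qed.

Lemma tends_to_cst l : tends_to N (fun=> l) l.
Proof. by rewrite /tends_to subrr cnorm0; exact: cvg_cst. Qed.

Lemma tends_toD u v l m : tends_to N u l -> tends_to N v m ->
  tends_to N (fun n => u n + v n) (l + m).
Proof.
move=> ul vm; apply: (squeeze0 (g := fun n => N (u n - l) + N (v n - m))).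
  by move=> n; rewrite cnorm_ge0 opprD addrACA (cnormD hN).
by rewrite -[0]addr0; exact: cvgD.
Qed.

Lemma tends_toZ c u l : tends_to N u l ->
  tends_to N (fun n => c *: u n) (c *: l).
Proof.
move=> ul; apply: (squeeze0 (g := fun n => modulus c * N (u n - l))).
  by move=> n; rewrite cnorm_ge0 -scalerBr (cnormZ hN) lexx.
by rewrite -[0](mulr0 (modulus c)); apply: cvgM ul; exact: cvg_cst.
Qed.

Lemma tends_to_star u l : tends_to N u l ->
  tends_to N (fun n => star (u n)) (star l).
Proof.
move=> ul; rewrite /tends_to.
by under eq_fun do rewrite -starN -starD cnorm_star.
Qed.

Lemma tends_to_cnorm u l : tends_to N u l -> (fun n => N (u n)) @ \oo --> N l.
Proof.
move=> ul; apply/subr_cvg0/norm_cvg0P.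
by apply: (squeeze0 _ ul) => n; rewrite normr_ge0 cnorm_dist.
Qed.

Lemma tends_toM u v l m : tends_to N u l -> tends_to N v m ->
  tends_to N (fun n => u n ** v n) (l ** m).
Proof.
move=> ul vm.
apply: (squeeze0 (g := fun n => N (u n - l) * N (v n) + N l * N (v n - m))).
  move=> n; rewrite cnorm_ge0 /=.
  have -> : u n ** v n - l ** m = (u n - l) ** v n + l ** (v n - m).
    by rewrite !smulE addrA subrK.
  exact: le_trans (cnormD hN _ _) (lerD (cnormM hN _ _) (cnormM hN _ _)).
rewrite (_ : (0 : R) = 0 * N m + N l * 0); last by rewrite mul0r mulr0 addr0.
apply: cvgD; apply: cvgM => //; first exact: tends_to_cnorm.
exact: cvg_cst.
Qed.

Lemma tends_to_le u l r :
  tends_to N u l -> (forall n, N (u n) <= r) -> N l <= r.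
Proof.
move=> ul ur; have h := tends_to_cnorm ul; rewrite -(cvg_lim _ h) //.
apply: limr_le; first by apply/cvg_ex; exists (N l).
by near=> n; exact: ur.
Unshelve. all: by end_near.
Qed.

End CStarNorms.

(** * Square roots in a complete C*-normed algebra *)

Section SquareRoot.
Variables (R : realType) (U : unitalStarAlgType R[i]) (N : U -> R).
Hypotheses (hN : cstar_norm N) (N_complete : complete_for N).
Local Notation e := (sone : U).
Implicit Types (a h s x y : U) (r t : R).

Lemma cnorm1_le1 : N e <= 1.
Proof.
have := cnorm_star_mul hN e; rewrite star_one smul1x => h.
have := cnorm_ge0 hN e; nra.
Qed.

Section Iteration.
Variable h : U.
Hypotheses (h_sa : self_adjoint h) (h_le1 : N h <= 1).

(** If w is a fixed point of x |-> (h + x^2) / 2 then (1 - w)^2 = 1 - h, so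
    iterating from 0 computes 1 - sqrt (1 - h).  All iterates are polynomials
    in h. *)
Definition root_step x : U := (2^-1)%:C *: (h + x ** x).
Definition root_approx n : U := iter n root_step 0.
(** The same iteration for the scalar h = 1, the largest value allowed for
    the norm of h: it dominates the iteration in the algebra and, being
    monotone and bounded by 1, converges.  This is why the boundary case
    N h = 1 needs no separate treatment. *)
Definition real_step r : R := (1 + r ^+ 2) / 2.
Definition real_approx n : R := iter n real_step 0.

Lemma real_approx_bounds n :
  0 <= real_approx n <= 1 /\ real_approx n <= real_approx n.+1.
Proof.
have step b : 0 <= b <= 1 -> b <= real_step b ->
    0 <= real_step b <= 1 /\ real_step b <= real_step (real_step b).
  move=> /andP[b0 b1] bS; split; rewrite /real_step in bS *.
    by apply/andP; split; nra.
  have : b ^+ 2 <= ((1 + b ^+ 2) / 2) ^+ 2; last by lra.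
  by rewrite ler_pXn2r // nnegrE; nra.
elim: n => [|n [b01 bS]]; first by rewrite /= /real_step; lra.
exact: step.
Qed.

Lemma root_approx_commute x n : commute x h -> commute x (root_approx n).
Proof.
move=> xh; elim: n => [|n IH]; first by rewrite /commute smulx0 smul0x.
rewrite /commute /= /root_step !smulE xh; congr (_ *: (_ + _)).
by rewrite smulA IH -smulA IH smulA.
Qed.

Lemma root_approx_sa n : self_adjoint (root_approx n).
Proof.
elim: n => [|n IH]; first exact: star0.
by rewrite /self_adjoint /= /root_step !starE conj_real IH h_sa.
Qed.

Lemma root_approx_norm n : N (root_approx n) <= real_approx n.
Proof.
elim: n => [|n IH] /=; first by rewrite cnorm0.
rewrite /root_step /real_step cnorm_real // ger0_norm ?invr_ge0 // mulrC.
apply: ler_wpM2r; first by rewrite invr_ge0.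
apply: le_trans (cnormD hN _ _) _; apply: lerD => //.
apply: le_trans (cnormM hN _ _) _.
by rewrite expr2 ler_pM // ?cnorm_ge0.
Qed.

Lemma root_step_sub x y : commute y x ->
  root_step x - root_step y = (2^-1)%:C *: ((x - y) ** (x + y)).
Proof.
move=> yx; rewrite /root_step -scalerBr; congr (_ *: _).
by rewrite !smulE yx; linear_identity.
Qed.

(** Consecutive iterates commute, so the difference of their squares factors
    as in the scalar case, and the bound propagates factor by factor. *)
Lemma root_approx_step n :
  N (root_approx n.+1 - root_approx n) <= real_approx n.+1 - real_approx n.
Proof.
elim: n => [|n IH].
  rewrite /= /root_step /real_step !subr0 smul0x addr0 cnorm_real //.
  rewrite ger0_norm ?invr_ge0 // expr0n addr0 mul1r.
  by rewrite ler_piMr ?invr_ge0.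
have comm : commute (root_approx n) (root_approx n.+1).
  by apply/root_approx_commute/esym/root_approx_commute.
have -> : root_approx n.+2 - root_approx n.+1 = (2^-1)%:C *:
    ((root_approx n.+1 - root_approx n) ** (root_approx n.+1 + root_approx n)).
  exact: root_step_sub.
rewrite cnorm_real // ger0_norm ?invr_ge0 //.
have -> : real_approx n.+2 - real_approx n.+1 = 2^-1 *
    ((real_approx n.+1 - real_approx n) * (real_approx n.+1 + real_approx n)).
  have sub b c : real_step b - real_step c = 2^-1 * ((b - c) * (b + c)).
    by rewrite /real_step; field.
  exact: sub.
apply: ler_wpM2l; first by rewrite invr_ge0.
apply: le_trans (cnormM hN _ _) _; apply: ler_pM; rewrite ?cnorm_ge0 //.
apply: le_trans (cnormD hN _ _) _.
exact: lerD (root_approx_norm _) (root_approx_norm _).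
Qed.

Lemma root_approx_dist m n : (n <= m)%N ->
  N (root_approx m - root_approx n) <= real_approx m - real_approx n.
Proof.
move=> /subnK <-; elim: (m - n)%N => [|k IH]; first by rewrite !subrr cnorm0.
apply: le_trans (cnorm_triangle hN (root_approx (k + n)) _ _) _.
apply: le_trans (lerD (root_approx_step _) IH) _.
by rewrite addrA subrK.
Qed.

Lemma root_approx_cauchy : cauchy_for N root_approx.
Proof.
move=> eps eps0.
have incr : {homo real_approx : m n / (m <= n)%N >-> m <= n}.
  by apply/nondecreasing_seqP => n; have [] := real_approx_bounds n.
have /cvg_ex[l /= cvl] : cvgn real_approx.
  apply: nondecreasing_is_cvgn => //; exists 1 => _ [n _ <-].
  by have [/andP[]] := real_approx_bounds n.
have eps2 : 0 < eps / 2 by rewrite divr_gt0.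
have /cvgrPdist_le /(_ _ eps2)[K _ hK] := cvl.
suff main m n : (K <= n)%N -> (n <= m)%N ->
    N (root_approx m - root_approx n) <= eps.
  exists K => m n Km Kn; have [nm|mn] := leqP n m; first exact: main.
  by rewrite cnormB //; apply: main => //; exact: ltnW.
move=> Kn nm; apply: le_trans (root_approx_dist nm) _.
have := hK n Kn; have := hK m (leq_trans Kn nm).
rewrite /= !ler_norml => /andP[? ?] /andP[? ?]; lra.
Qed.

Lemma root_limit : exists w, [/\ self_adjoint w, N w <= 1,
  2%:C *: w = h + w ** w & forall x, commute x h -> commute x w].
Proof.
have [w lim_w] := N_complete root_approx_cauchy; exists w; split.
- apply: (tends_to_unique hN _ lim_w).
  have <- : (fun n => star (root_approx n)) = root_approx.
    by apply/funext => n; exact: root_approx_sa.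
  exact: tends_to_star.
- apply: (tends_to_le hN lim_w) => n.
  apply: le_trans (root_approx_norm n) _.
  by have [/andP[]] := real_approx_bounds n.
- have wS : tends_to N (fun n => root_approx n.+1) w.
    move: lim_w; rewrite /tends_to.
    by rewrite -(cvg_shiftS (fun n => N (root_approx n - w))).
  have wS' : tends_to N (fun n => root_approx n.+1) ((2^-1)%:C *: (h + w ** w)).
    apply: (tends_toZ hN); apply: (tends_toD hN); first exact: tends_to_cst.
    exact: tends_toM.
  rewrite {1}(tends_to_unique hN wS wS') scalerA -rmorphM /=.
  by rewrite mulfV ?pnatr_eq0 // rmorph1 scale1r.
move=> x xh; apply: (tends_to_unique hN (u := fun n => x ** root_approx n)).
  by apply: (tends_toM hN) => //; exact: tends_to_cst.
under eq_fun do rewrite root_approx_commute //.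
by apply: (tends_toM hN) => //; exact: tends_to_cst.
Qed.

End Iteration.

(** For a self-adjoint element of a C*-algebra, N (t - a) <= t says that the
    spectrum of a lies in [0, 2t]; this describes the positive elements
    without mentioning the spectrum. *)
Definition nonneg a := self_adjoint a /\
  exists2 t, 0 < t & N (t%:C *: e - a) <= t.

Lemma nonneg_scale r a : 0 < r -> nonneg a -> nonneg (r%:C *: a).
Proof.
move=> r0 [sa [t t0 ta]]; split.
  by rewrite /self_adjoint !starE conj_real sa.
exists (r * t); first exact: mulr_gt0.
rewrite rmorphM -scalerA -scalerBr cnorm_real // gtr0_norm //.
by rewrite ler_pM2l.
Qed.

(** After scaling by 1/t, a = 1 - h with N h <= 1, and 1 - w is a square root of
    a, with w the limit of the iteration.  Moreover N w <= 1 makes 1 - w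
    nonnegative with t = 1. *)
Lemma nonneg_sqrt a : nonneg a ->
  exists s, [/\ nonneg s, s ** s = a & forall x, commute x a -> commute x s].
Proof.
move=> [sa [t t0 ta]].
have tC0 : t%:C != 0 :> R[i] by rewrite (inj_eq (@complexI R)) gt_eqF.
have tV : t%:C * (t^-1)%:C = 1 :> R[i].
  by rewrite -rmorphM /= mulfV ?gt_eqF // rmorph1.
have h_sa : self_adjoint (e - (t^-1)%:C *: a).
  by rewrite /self_adjoint !starE star_one conj_real sa.
have h_le1 : N (e - (t^-1)%:C *: a) <= 1.
  rewrite -(ler_pM2l t0) mulr1; apply: le_trans ta.
  by rewrite -{1}(gtr0_norm t0) -cnorm_real // scalerBr scalerA tV scale1r.
have [w [w_sa w1 w_eq w_comm]] := root_limit h_sa h_le1.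
exists ((Num.sqrt t)%:C *: (e - w)); split.
- apply: nonneg_scale; first by rewrite sqrtr_gt0.
  split; first by rewrite /self_adjoint !starE star_one w_sa.
  by exists 1 => //; rewrite rmorph1 scale1r opprB addrC subrK.
- rewrite smulZl smulZr !smulE scalerA -rmorphM -expr2.
  rewrite sqr_sqrtr ?ltW //= !smul1x smulx1.
  have -> : w ** w = 2%:C *: w - (e - (t^-1)%:C *: a).
    by rewrite w_eq addrC addKr.
  rewrite -[RHS]scale1r -tV -scalerA; congr (_ *: _).
  linear_identity.
- move=> x xa; rewrite /commute !smulE smul1x smulx1 w_comm //.
  by rewrite /commute !smulE smul1x smulx1 xa.
Qed.

End SquareRoot.

(** * Positivity of x^* x *)

Section CartesianForm.
Variables (R : realType) (A : unitalStarAlgType R[i]).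
Implicit Types x y : A.

Lemma conj_i : Num.conj ('i : R[i]) = - 'i.
Proof. exact: conjCi. Qed.

Lemma scale_ii x : 'i *: ('i *: x) = - x.
Proof. by rewrite scalerA -expr2 sqrCi scaleN1r. Qed.

Lemma cartesian_star_mul x y : self_adjoint x -> self_adjoint y ->
  star (x + 'i *: y) ** (x + 'i *: y) =
  x ** x + y ** y + 'i *: (x ** y - y ** x).
Proof.
move=> sx sy; rewrite !starE conj_i sx sy !(smulE, scalerDr) !scaleNr scale_ii.
linear_identity.
Qed.

End CartesianForm.

Section Positivity.
Variables (R : realType) (U : unitalStarAlgType R[i]) (N : U -> R).
Hypotheses (hN : cstar_norm N) (N_complete : complete_for N).
Local Notation e := (sone : U).
Local Notation nonneg := (nonneg N).
Local Notation nonneg_sqrt := (nonneg_sqrt hN N_complete).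
Implicit Types (a b h s x y : U) (r t : R).

(** Scale to a self-adjoint b of norm at most 1.  If r is the square root of
    1 - b^2, then r + i b is unitary, hence of norm at most 1, and so is its
    real part r: N (1 - b^2) = N (r^2) <= 1. *)
Lemma nonneg_square a : self_adjoint a -> nonneg (a ** a).
Proof.
move=> sa.
(* The added 1 keeps the scaling factor positive when a = 0. *)
pose t := N a + 1.
have t0 : 0 < t by rewrite ltr_wpDl ?cnorm_ge0.
pose b := (t^-1)%:C *: a.
have sb : self_adjoint b by rewrite /self_adjoint !starE conj_real sa.
have b1 : N b <= 1.
  rewrite cnorm_real // gtr0_norm ?invr_gt0 // ler_pdivrMl // mulr1 /t; lra.
have -> : a ** a = (t * t)%:C *: (b ** b).
  rewrite /b smulZl smulZr !scalerA -!rmorphM /=.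
  by rewrite (_ : t * t * _ = 1) ?rmorph1 ?scale1r //; field; rewrite gt_eqF.
apply: nonneg_scale => //; first exact: mulr_gt0.
have sbb : self_adjoint (b ** b) by rewrite /self_adjoint starM sb.
have [|r [[sr _] r_sq r_comm]] := @nonneg_sqrt (e - b ** b).
  split; first by rewrite /self_adjoint starD starN star_one sbb.
  exists 1 => //; rewrite rmorph1 scale1r opprB addrC subrK.
  by apply: le_trans (cnormM hN _ _) _; rewrite mulr_ile1 ?cnorm_ge0.
have rb : b ** r = r ** b.
  by apply: r_comm; rewrite /commute !smulE smul1x smulx1 smulA.
pose u := r + 'i *: b.
have u1 : N u <= 1.
  have := cnorm_star_mul hN u; rewrite cartesian_star_mul // rb subrr scaler0.
  rewrite r_sq addr0 subrK => uu; have := cnorm1_le1 hN.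
  by have := cnorm_ge0 hN u; nra.
have r1 : N r <= 1.
  have h2 : u + star u = 2%:C *: r.
    by rewrite /u starD starZ conj_i sr sb; linear_identity.
  have := cnormD hN u (star u).
  rewrite h2 (cnorm_star hN) cnorm_real // ger0_norm //.
  by lra.
split => //; exists 1 => //; rewrite rmorph1 scale1r -r_sq.
by apply: le_trans (cnormM hN _ _) _; rewrite mulr_ile1 ?cnorm_ge0.
Qed.

Lemma nonneg0 : nonneg 0.
Proof. by rewrite -(smul0x 0); apply: nonneg_square; exact: star0. Qed.

Lemma nonnegD x y : nonneg x -> nonneg y -> nonneg (x + y).
Proof.
move=> [sx [t t0 tx]] [sy [t' t'0 t'y]]; split.
  by rewrite /self_adjoint starD sx sy.
exists (t + t'); first exact: addr_gt0.
rewrite rmorphD scalerDl opprD addrACA.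
exact: le_trans (cnormD hN _ _) (lerD _ _).
Qed.

Lemma nonneg_sum n (F : 'I_n -> U) :
  (forall j, nonneg (F j)) -> nonneg (\sum_(j < n) F j).
Proof.
by move=> F0; elim/big_ind: _ => // [|x y]; [exact: nonneg0 | exact: nonnegD].
Qed.

(** If x = s^2 and - x = r^2 with commuting self-adjoint s and r, then s + i r
    is normal with (s + i r)^* (s + i r) = s^2 + r^2 = 0. *)
Lemma nonneg_antisym x : nonneg x -> nonneg (- x) -> x = 0.
Proof.
move=> x0 Nx0.
have [s [[ss _] s_sq _]] := nonneg_sqrt x0.
have [r [[sr _] r_sq r_comm]] := nonneg_sqrt Nx0.
have rs : s ** r = r ** s.
  by apply: r_comm; rewrite /commute -s_sq !smulE smulA.
have u0 : s + 'i *: r = 0.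
  apply: (star_mul_eq0 hN).
  by rewrite cartesian_star_mul // rs subrr scaler0 addr0 s_sq r_sq subrr.
have su0 : s - 'i *: r = 0.
  by have := congr1 (@star _ U) u0; rewrite star0 !starE conj_i ss sr scaleNr.
suff s0 : 2%:C *: s = 0.
  apply/eqP; rewrite -s_sq; move/eqP: s0; rewrite scaler_eq0 => /orP[|/eqP->].
    by rewrite (inj_eq (@complexI R)) pnatr_eq0.
  by rewrite smul0x.
by rewrite -[RHS]addr0 -{1}u0 -su0; linear_identity.
Qed.

Lemma nonneg_add_eq0 x y : nonneg x -> nonneg y -> x + y = 0 -> x = 0.
Proof.
move=> x0 y0 xy; apply: nonneg_antisym => //.
by rewrite -(addr0 (- x)) -xy addKr.
Qed.

(** With p = x + x^* and q = i (x - x^* ), both self-adjoint,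
    p^2 + q^2 = 2 (x^* x + x x^* ). *)
Lemma nonneg_star_mul_add x : nonneg (star x ** x + x ** star x).
Proof.
have sp : self_adjoint (x + star x) by rewrite /self_adjoint starD starK addrC.
have sq : self_adjoint ('i *: (x - star x)).
  by rewrite /self_adjoint !starE conj_i starK scaleNr -scalerN opprB.
have -> : star x ** x + x ** star x = (2^-1)%:C *:
    ((x + star x) ** (x + star x) +
     ('i *: (x - star x)) ** ('i *: (x - star x))).
  have -> : ('i *: (x - star x)) ** ('i *: (x - star x)) =
      - ((x - star x) ** (x - star x)) by rewrite smulZl smulZr scale_ii.
  have -> : (x + star x) ** (x + star x) - (x - star x) ** (x - star x) =
      2%:C *: (star x ** x + x ** star x) by rewrite !smulE; linear_identity.
  by rewrite scalerA -rmorphM mulVf ?pnatr_eq0 // rmorph1 scale1r.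
apply: nonneg_scale => //.
by apply: nonnegD; exact: nonneg_square.
Qed.

(** For z = y c one computes z^* z = - (c^2)^2 and z z^* = - (y y^* )^2.  The
    sum z^* z + z z^* is nonnegative, so both squares vanish. *)
Lemma star_mul_neg_square y c : self_adjoint c ->
  star y ** y = - (c ** c) -> y = 0.
Proof.
move=> sc yy; pose z := y ** c.
have zz : star z ** z = - ((c ** c) ** (c ** c)).
  by rewrite /z starM sc smulA -(smulA c) yy !smulE !smulA.
have zz' : z ** star z = - ((y ** star y) ** (y ** star y)).
  rewrite /z starM sc -smulA (smulA c) -(opprK (c ** c)) -yy !smulE.
  by rewrite !smulA.
have scc : self_adjoint (c ** c) by rewrite /self_adjoint starM sc.
have syy : self_adjoint (y ** star y) by rewrite /self_adjoint starM starK.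
have S0 := nonnegD (nonneg_square scc) (nonneg_square syy).
have := nonneg_star_mul_add z; rewrite zz zz' -opprD => NS0.
have cc0 : (c ** c) ** (c ** c) = 0.
  by apply: nonneg_add_eq0 (nonneg_antisym S0 NS0); exact: nonneg_square.
apply: (star_mul_eq0 hN); rewrite yy (_ : c ** c = 0) ?oppr0 //.
by apply: (star_mul_eq0 hN); rewrite scc.
Qed.

(** Let h = x^* x, let m be the square root of h^2, that is |h|, and let
    v = m - h be twice the negative part of h.  Then h v = - m v, hence
    (x v)^* (x v) = v h v = - (n v)^2, where n is the square root of m. *)
Lemma nonneg_star_mul x : nonneg (star x ** x).
Proof.
set h := star x ** x.
have sh : self_adjoint h by rewrite /self_adjoint /h starM starK.
have [m [m0 m_sq m_comm]] := nonneg_sqrt (nonneg_square sh).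
have mh : h ** m = m ** h by apply: m_comm; rewrite /commute smulA.
have [n [[sn _] n_sq n_comm]] := nonneg_sqrt m0.
have nh : h ** n = n ** h by exact: n_comm.
have nm : n ** m = m ** n by rewrite -n_sq smulA.
have [sm _] := m0.
pose v := m - h.
have sv : self_adjoint v by rewrite /self_adjoint /v starD starN sm sh.
have nv : v ** n = n ** v by rewrite /v !smulE nh nm.
have hv : h ** v = - (m ** v) by rewrite /v !smulE mh m_sq; linear_identity.
have nnv : (n ** v) ** (n ** v) = v ** (m ** v).
  by rewrite -{1}nv smulA -(smulA v n n) n_sq !smulA.
have xv0 : x ** v = 0.
  apply: (@star_mul_neg_square _ (n ** v)).
    by rewrite /self_adjoint starM sn sv nv.
  by rewrite starM sv smulA -(smulA v) -/h nnv -smulA hv smulNr.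
have hv0 : h ** v = 0 by rewrite /h -smulA xv0 smulx0.
have mv0 : m ** v = 0 by rewrite -[m ** v]opprK -hv hv0 oppr0.
have v0 : v = 0.
  by apply: (star_mul_eq0 hN); rewrite sv {1}/v smulDl smulNl hv0 mv0 subrr.
by rewrite (_ : h = m) //; apply/esym/eqP; rewrite -subr_eq0; apply/eqP.
Qed.

Lemma sum_star_mul_eq0 n (x : 'I_n -> U) :
  \sum_(j < n) star (x j) ** x j = 0 -> forall j, x j = 0.
Proof.
move=> S0 j; apply: (star_mul_eq0 hN).
move: S0; rewrite (bigD1 j) //=; apply: nonneg_add_eq0.
  exact: nonneg_star_mul.
rewrite big_mkcond; apply: nonneg_sum => k.
by case: ifP => _; [exact: nonneg_star_mul | exact: nonneg0].
Qed.

End Positivity.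

(** * Completion of a C*-normed algebra *)

Section Completion.
Local Open Scope quotient_scope.
Variables (R : realType) (A : unitalStarAlgType R[i]) (N : A -> R).
Hypothesis hN : cstar_norm N.

Definition cauchy_seq := {u : nat -> A | cauchy_for N u}.
HB.instance Definition _ := gen_eqMixin cauchy_seq.
HB.instance Definition _ := gen_choiceMixin cauchy_seq.
Implicit Types (u v w : cauchy_seq).

(** Two sequences represent the same point of the completion when their
    distance tends to 0. *)
Definition null_diff (u v : nat -> A) :=
  (fun n => N (u n - v n)) @ \oo --> (0 : R).

Definition cauchy_eqv u v : bool := `[< null_diff (sval u) (sval v) >].

Fact null_diff_refl (u : nat -> A) : null_diff u u.
Proof.
by rewrite /null_diff; under eq_fun do rewrite subrr cnorm0 //; exact: cvg_cst.
Qed.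

Fact null_diff_sym (u v : nat -> A) : null_diff u v -> null_diff v u.
Proof. by move=> uv; rewrite /null_diff; under eq_fun do rewrite cnormB //. Qed.

Fact null_diff_trans (v u w : nat -> A) :
  null_diff u v -> null_diff v w -> null_diff u w.
Proof.
move=> uv vw.
by apply: squeeze0D uv vw => n; rewrite cnorm_ge0 ?cnorm_triangle.
Qed.

Fact cauchy_eqv_refl : reflexive cauchy_eqv.
Proof. by move=> u; apply/asboolP; exact: null_diff_refl. Qed.

Fact cauchy_eqv_sym : symmetric cauchy_eqv.
Proof. by move=> u v; apply/asboolP/asboolP; exact: null_diff_sym. Qed.

Fact cauchy_eqv_trans : transitive cauchy_eqv.
Proof.
move=> v u w /asboolP uv /asboolP vw; apply/asboolP.
exact: null_diff_trans uv vw.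
Qed.

Canonical cauchy_equiv :=
  EquivRel cauchy_eqv cauchy_eqv_refl cauchy_eqv_sym cauchy_eqv_trans.

Definition completion : Type := {eq_quot cauchy_equiv}.
HB.instance Definition _ := Choice.copy completion {eq_quot cauchy_equiv}.

Definition limit_of u : completion := \pi_{eq_quot cauchy_equiv} u.
Definition approximant (x : completion) : cauchy_seq :=
  @repr _ {eq_quot cauchy_equiv} x.

Lemma approximantK x : limit_of (approximant x) = x.
Proof. exact: reprK. Qed.

Lemma limit_of_surj x : exists u, x = limit_of u.
Proof. by exists (approximant x); rewrite approximantK. Qed.

Lemma limit_of_eqP u v :
  limit_of u = limit_of v <-> null_diff (sval u) (sval v).
Proof.
split=> [/eqP|uv]; first by rewrite eqmodE => /asboolP.
by apply/eqP; rewrite eqmodE; exact/asboolP.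
Qed.

Lemma limit_of_ext u v :
  (forall n, sval u n = sval v n) -> limit_of u = limit_of v.
Proof.
move=> uv; apply/limit_of_eqP; rewrite /null_diff.
under eq_fun do rewrite uv subrr cnorm0 //.
exact: cvg_cst.
Qed.

Lemma cauchy_norm_cvg u : cvgn (fun n => N (sval u n)).
Proof.
apply/cauchy_cvgP/cauchy_exP => eps eps0.
have eps2 : 0 < eps / 2 by rewrite divr_gt0.
have [K hK] := proj2_sig u _ eps2; exists (N (sval u K)), K => // n /= Kn.
rewrite /ball /= (le_lt_trans (cnorm_dist hN _ _)) //.
by rewrite (le_lt_trans (hK _ _ _ _)) // ltr_pdivrMr // ltr_pMr // ltr1n.
Qed.

Lemma cauchy_norm_bounded u :
  exists2 M, 0 < M & exists K, forall n, (K <= n)%N -> N (sval u n) <= M.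
Proof.
have [K hK] := proj2_sig u _ ltr01; exists (N (sval u K) + 1).
  by rewrite ltr_wpDl ?cnorm_ge0.
exists K => n Kn; have := hK n K Kn (leqnn _).
have := cnorm_dist hN (sval u n) (sval u K); rewrite ler_norml => /andP[_].
by move=> ? ?; lra.
Qed.

Fact cauchy_add u v : cauchy_for N (fun n => sval u n + sval v n).
Proof.
move=> eps eps0; have eps2 : 0 < eps / 2 by rewrite divr_gt0.
have [K hK] := proj2_sig u _ eps2; have [L hL] := proj2_sig v _ eps2.
exists (maxn K L) => m n; rewrite !geq_max => /andP[Km Lm] /andP[Kn Ln].
rewrite opprD addrACA; apply: le_trans (cnormD hN _ _) _.
have := hK m n Km Kn; have := hL m n Lm Ln; lra.
Qed.

Fact cauchy_scale c u : cauchy_for N (fun n => c *: sval u n).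
Proof.
move=> eps eps0; have c0 := modulus_ge0 c.
have c1 : 0 < modulus c + 1 by lra.
have [K hK] := proj2_sig u _ (divr_gt0 eps0 c1); exists K => m n Km Kn.
rewrite -scalerBr (cnormZ hN).
have := hK m n Km Kn; rewrite ler_pdivlMr //.
by have := cnorm_ge0 hN (sval u m - sval u n); nra.
Qed.

Fact cauchy_star u : cauchy_for N (fun n => star (sval u n)).
Proof.
move=> eps eps0; have [K hK] := proj2_sig u _ eps0; exists K => m n Km Kn.
by rewrite -starN -starD cnorm_star //; exact: hK.
Qed.

Lemma cnorm_smulB x y x' y' :
  N (x ** y - x' ** y') <= N (x - x') * N y + N x' * N (y - y').
Proof.
have -> : x ** y - x' ** y' = (x - x') ** y + x' ** (y - y').
  by rewrite !smulE addrA subrK.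
exact: le_trans (cnormD hN _ _) (lerD (cnormM hN _ _) (cnormM hN _ _)).
Qed.

Fact cauchy_mul u v : cauchy_for N (fun n => sval u n ** sval v n).
Proof.
move=> eps eps0.
have [M M0 [K hK]] := cauchy_norm_bounded u.
have [M' M'0 [K' hK']] := cauchy_norm_bounded v.
have MM : 0 < M + M' by lra.
have [L hL] := proj2_sig u _ (divr_gt0 eps0 MM).
have [L' hL'] := proj2_sig v _ (divr_gt0 eps0 MM).
exists (maxn (maxn K K') (maxn L L')) => m n; rewrite !geq_max.
move=> /andP[/andP[Km Km'] /andP[Lm Lm']] /andP[/andP[Kn Kn'] /andP[Ln Ln']].
apply: le_trans (cnorm_smulB _ _ _ _) _.
have -> : eps = eps / (M + M') * M' + M * (eps / (M + M')).
  by field; rewrite gt_eqF.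
apply: lerD; apply: ler_pM; rewrite ?cnorm_ge0 //.
- exact: hL.
- exact: hK'.
- exact: hK.
- exact: hL'.
Qed.

Fact cauchy_cst a : cauchy_for N (fun=> a).
Proof.
by move=> eps eps0; exists 0%N => m n _ _; rewrite subrr cnorm0 // ltW.
Qed.

Definition add_seq u v : cauchy_seq := exist _ _ (cauchy_add u v).
Definition scale_seq c u : cauchy_seq := exist _ _ (cauchy_scale c u).
Definition star_seq u : cauchy_seq := exist _ _ (cauchy_star u).
Definition mul_seq u v : cauchy_seq := exist _ _ (cauchy_mul u v).
Definition cst_seq a : cauchy_seq := exist _ _ (cauchy_cst a).
Definition embed a : completion := limit_of (cst_seq a).

(** The operations act termwise on chosen representatives; the equations
    [lim_opE] below show that any representative may be used. *)
Definition lim_add x y := limit_of (add_seq (approximant x) (approximant y)).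
Definition lim_scale c x := limit_of (scale_seq c (approximant x)).
Definition lim_star x := limit_of (star_seq (approximant x)).
Definition lim_mul x y := limit_of (mul_seq (approximant x) (approximant y)).

Lemma approximant_limit u :
  null_diff (sval (approximant (limit_of u))) (sval u).
Proof. by apply/limit_of_eqP; rewrite approximantK. Qed.

Lemma lim_addE u v : lim_add (limit_of u) (limit_of v) = limit_of (add_seq u v).
Proof.
apply/limit_of_eqP.
apply: (squeeze0D _ (approximant_limit u) (approximant_limit v)) => n.
by rewrite cnorm_ge0 //= opprD addrACA (cnormD hN).
Qed.

Lemma lim_scaleE c u : lim_scale c (limit_of u) = limit_of (scale_seq c u).
Proof.
apply/limit_of_eqP; rewrite /null_diff /=.
under eq_fun do rewrite -scalerBr (cnormZ hN).
rewrite -[0](mulr0 (modulus c)); apply: cvgM; first exact: cvg_cst.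
exact: approximant_limit.
Qed.

Lemma lim_starE u : lim_star (limit_of u) = limit_of (star_seq u).
Proof.
apply/limit_of_eqP; rewrite /null_diff /=.
under eq_fun do rewrite -starN -starD cnorm_star //.
exact: approximant_limit.
Qed.

Lemma lim_mulE u v : lim_mul (limit_of u) (limit_of v) = limit_of (mul_seq u v).
Proof.
apply/limit_of_eqP; apply: squeeze0D => [n | |].
- by rewrite cnorm_ge0 //=; exact: cnorm_smulB.
- set w := approximant (limit_of v).
  rewrite -[0](mul0r (lim (N (sval w n) @[n --> \oo]))).
  by apply: cvgM; [exact: approximant_limit | exact: cauchy_norm_cvg].
rewrite -[0](mulr0 (lim (N (sval u n) @[n --> \oo]))).
by apply: cvgM; [exact: cauchy_norm_cvg | exact: approximant_limit].
Qed.

Definition lim_opE := (lim_addE, lim_scaleE, lim_starE, lim_mulE).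

Ltac lift_to_sequences x u := case: (limit_of_surj x) => u ->; clear x.

(** An algebraic law passes to the completion because it holds at each index
    of representing sequences. *)
Ltac termwise :=
  repeat match goal with
  | x : completion |- _ => let u := fresh "u" in lift_to_sequences x u
  end;
  rewrite !lim_opE; apply: limit_of_ext => n /=.

Definition lim_zero : completion := embed 0.
Definition lim_one : completion := embed sone.

Fact lim_addA : associative lim_add.
Proof. by move=> x y z; termwise; rewrite addrA. Qed.

Fact lim_addC : commutative lim_add.
Proof. by move=> x y; termwise; rewrite addrC. Qed.

Fact lim_add0 : left_id lim_zero lim_add.
Proof. by move=> x; termwise; rewrite add0r. Qed.

Fact lim_addN : left_inverse lim_zero (lim_scale (-1)) lim_add.
Proof. by move=> x; termwise; rewrite scaleN1r addNr. Qed.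

HB.instance Definition _ := GRing.isZmodule.Build completion
  lim_addA lim_addC lim_add0 lim_addN.

Fact lim_scaleA c d x : lim_scale c (lim_scale d x) = lim_scale (c * d) x.
Proof. by termwise; rewrite scalerA. Qed.

Fact lim_scale1 : left_id 1 lim_scale.
Proof. by move=> x; termwise; rewrite scale1r. Qed.

Fact lim_scaleDr c x y :
  lim_scale c (lim_add x y) = lim_add (lim_scale c x) (lim_scale c y).
Proof. by termwise; rewrite scalerDr. Qed.

Fact lim_scaleDl x c d :
  lim_scale (c + d) x = lim_add (lim_scale c x) (lim_scale d x).
Proof. by termwise; rewrite scalerDl. Qed.

HB.instance Definition _ := GRing.Zmodule_isLmodule.Build R[i] completion
  lim_scaleA lim_scale1 lim_scaleDr lim_scaleDl.

Fact lim_mulA : associative lim_mul.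
Proof. by move=> x y z; termwise; rewrite smulA. Qed.

Fact lim_mulDl x y z :
  lim_mul (lim_add x y) z = lim_add (lim_mul x z) (lim_mul y z).
Proof. by termwise; rewrite smulDl. Qed.

Fact lim_mulDr x y z :
  lim_mul x (lim_add y z) = lim_add (lim_mul x y) (lim_mul x z).
Proof. by termwise; rewrite smulDr. Qed.

Fact lim_mulZl c x y :
  lim_mul (lim_scale c x) y = lim_scale c (lim_mul x y).
Proof. by termwise; rewrite smulZl. Qed.

Fact lim_mulZr c x y :
  lim_mul x (lim_scale c y) = lim_scale c (lim_mul x y).
Proof. by termwise; rewrite smulZr. Qed.

Fact lim_starK : involutive lim_star.
Proof. by move=> x; termwise; rewrite starK. Qed.

Fact lim_starD x y :
  lim_star (lim_add x y) = lim_add (lim_star x) (lim_star y).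
Proof. by termwise; rewrite starD. Qed.

Fact lim_starZ c x :
  lim_star (lim_scale c x) = lim_scale (Num.conj c) (lim_star x).
Proof. by termwise; rewrite starZ. Qed.

Fact lim_starM x y :
  lim_star (lim_mul x y) = lim_mul (lim_star y) (lim_star x).
Proof. by termwise; rewrite starM. Qed.

Fact lim_mul1x : left_id lim_one lim_mul.
Proof. by move=> x; termwise; rewrite smul1x. Qed.

Fact lim_mulx1 : right_id lim_one lim_mul.
Proof. by move=> x; termwise; rewrite smulx1. Qed.

HB.instance Definition _ := Lmodule_isStarAlgebra.Build R[i] completion
  lim_mulA lim_mulDl lim_mulDr lim_mulZl lim_mulZr
  lim_starK lim_starD lim_starZ lim_starM.
HB.instance Definition _ := StarAlgebra_isUnital.Build R[i] completion
  lim_mul1x lim_mulx1.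

Lemma limit_ofB u v :
  limit_of u - limit_of v = limit_of (add_seq u (scale_seq (-1) v)).
Proof. by rewrite -[LHS]/(lim_add _ (lim_scale _ _)) !lim_opE. Qed.

Lemma embed_is_hom : star_homomorphism embed.
Proof.
split=> [c a b|a b|a]; apply/esym.
- rewrite -[LHS]/(lim_add (lim_scale _ _) _) lim_scaleE lim_addE.
  by apply: limit_of_ext => n.
- by rewrite -[LHS]/(lim_mul _ _) !lim_opE; exact: limit_of_ext => n.
- by rewrite -[LHS]/(lim_star _) !lim_opE; exact: limit_of_ext => n.
Qed.

Definition limit_norm (x : completion) : R :=
  lim (N (sval (approximant x) n) @[n --> \oo]).

Lemma limit_norm_cvg u :
  (fun n => N (sval u n)) @ \oo --> limit_norm (limit_of u).
Proof.
apply/subr_cvg0/norm_cvg0P.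
have h : `|N (sval (approximant (limit_of u)) n) - limit_norm (limit_of u)|
    @[n --> \oo] --> (0 : R).
  by apply/norm_cvg0P/subr_cvg0; exact: cauchy_norm_cvg.
apply: (squeeze0D _ (approximant_limit u) h) => n; rewrite normr_ge0 /=.
apply: le_trans (ler_distD (N (sval (approximant (limit_of u)) n)) _ _) _.
by rewrite lerD2r distrC cnorm_dist.
Qed.

Lemma limit_norm_eq u (r : R) : (fun n => N (sval u n)) @ \oo --> r ->
  limit_norm (limit_of u) = r.
Proof.
by move=> ur; rewrite -(cvg_lim _ ur) // (cvg_lim _ (@limit_norm_cvg u)).
Qed.

Lemma limit_norm_le u r K : (forall n, (K <= n)%N -> N (sval u n) <= r) ->
  limit_norm (limit_of u) <= r.
Proof.
move=> ur; have h := @limit_norm_cvg u; rewrite -(cvg_lim _ h) //.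
apply: limr_le; first by apply/cvg_ex; eexists; exact: h.
by exists K => // n /= Kn; exact: ur.
Qed.

Lemma limit_norm_embed a : limit_norm (embed a) = N a.
Proof. by apply: limit_norm_eq; rewrite /=; exact: (cvg_cst (N a)). Qed.

Lemma limit_norm_is_cstar : cstar_norm limit_norm.
Proof.
split.
- move=> x; lift_to_sequences x u => u0.
  apply/limit_of_eqP; rewrite /null_diff /=.
  by under eq_fun do rewrite subr0; rewrite -u0; exact: limit_norm_cvg.
- move=> x y; lift_to_sequences x u; lift_to_sequences y v.
  rewrite -[limit_of u + _]/(lim_add _ _) lim_opE.
  apply: ler_cvg_to (@limit_norm_cvg _)
    (cvgD (@limit_norm_cvg u) (@limit_norm_cvg v)) _.
  by near=> n; exact: cnormD.
- move=> c x; lift_to_sequences x u; rewrite -[c *: _]/(lim_scale _ _) lim_opE.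
  apply: limit_norm_eq => /=; under eq_fun do rewrite (cnormZ hN).
  by apply: cvgM; [exact: cvg_cst | exact: limit_norm_cvg].
- move=> x y; lift_to_sequences x u; lift_to_sequences y v.
  rewrite -[limit_of u ** _]/(lim_mul _ _) lim_opE.
  apply: ler_cvg_to (@limit_norm_cvg _)
    (cvgM (@limit_norm_cvg u) (@limit_norm_cvg v)) _.
  by near=> n; exact: cnormM.
- move=> x; lift_to_sequences x u.
  rewrite -[star _ ** _]/(lim_mul (lim_star _) _) !lim_opE.
  apply: limit_norm_eq => /=; under eq_fun do rewrite (cnorm_star_mul hN) expr2.
  by rewrite expr2; apply: cvgM; exact: limit_norm_cvg.
Unshelve. all: by end_near.
Qed.

Lemma embed_dense (x : completion) eps :
  0 < eps -> exists a, limit_norm (x - embed a) <= eps.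
Proof.
move=> eps0; lift_to_sequences x u; have [K hK] := proj2_sig u _ eps0.
exists (sval u K); rewrite /embed limit_ofB.
apply: (@limit_norm_le _ _ K) => n Kn /=.
by rewrite scaleN1r; exact: hK.
Qed.

(** A Cauchy sequence X of the completion has the limit represented by a
    sequence a of elements of A with a k within 1 / (k + 1) of X k. *)
Lemma limit_norm_complete : complete_for limit_norm.
Proof.
have hL := limit_norm_is_cstar.
move=> X X_cauchy.
have /choice[a Xa] : forall k, exists a,
    limit_norm (X k - embed a) <= k.+1%:R^-1.
  by move=> k; apply: embed_dense; rewrite invr_gt0.
have a_cauchy : cauchy_for N a.
  move=> eps eps0; have eps3 : 0 < eps / 3 by rewrite divr_gt0.
  have [K hK] := inv_nat_small eps3; have [L hL'] := X_cauchy _ eps3.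
  exists (maxn K L) => m n; rewrite !geq_max => /andP[Km Lm] /andP[Kn Ln].
  have -> : N (a m - a n) = limit_norm (embed (a m) - embed (a n)).
    have [lin _ _] := embed_is_hom.
    have := lin (-1) (a n) (a m); rewrite !scaleN1r => h.
    by rewrite -limit_norm_embed addrC h addrC.
  have := cnorm_triangle hL (X m) (embed (a m)) (embed (a n)).
  have := cnorm_triangle hL (X n) (X m) (embed (a n)).
  have := le_trans (Xa m) (hK m Km); have := le_trans (Xa n) (hK n Kn).
  by rewrite (cnormB hL (embed (a m)) (X m)); have := hL' m n Lm Ln; lra.
pose l := limit_of (exist _ a a_cauchy : cauchy_seq); exists l.
apply/cvgr0Pnorm_le => eps eps0; have eps2 : 0 < eps / 2 by rewrite divr_gt0.
have [K hK] := inv_nat_small eps2; have [L hL'] := a_cauchy _ eps2.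
exists (maxn K L) => // k /=; rewrite geq_max => /andP[Kk Lk].
rewrite ger0_norm ?(cnorm_ge0 hL) //.
apply: le_trans (cnorm_triangle hL (embed (a k)) _ _) _.
have al : limit_norm (embed (a k) - l) <= eps / 2.
  rewrite limit_ofB; apply: (@limit_norm_le _ _ L) => n Ln /=.
  by rewrite scaleN1r; exact: hL'.
by have := le_trans (Xa k) (hK k Kk); lra.
Qed.

End Completion.

(** * Representability and C*-norms *)

Section CompleteCStarNorm.
Variables (R : realType) (B : starAlgType R[i]) (N : B -> R).
Hypotheses (hN : cstar_norm N) (N_complete : complete_for N).

(** An alias of the algebra that records the norm, so that the normed
    structures can be attached to it. *)
Definition cstar_carrier of cstar_norm N & complete_for N : Type := B.
Local Notation B' := (cstar_carrier hN N_complete).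
HB.instance Definition _ := StarAlgebra.copy B' B.

Definition complex_norm (x : B') : R[i] := (N x)%:C.

Fact complex_normD x y :
  complex_norm (x + y) <= complex_norm x + complex_norm y.
Proof. by rewrite -rmorphD lecR; exact: (cnormD hN). Qed.

Fact complex_normZ c x : complex_norm (c *: x) = `|c| * complex_norm x.
Proof. by rewrite -modulusE -rmorphM; congr (_%:C); exact: (cnormZ hN). Qed.

Fact complex_norm0_eq0 x : complex_norm x = 0 -> x = 0.
Proof. by move=> /complexI; exact: (cnorm_eq0 hN). Qed.

HB.instance Definition _ := Lmodule_isNormed.Build R[i] B'
  complex_normD complex_normZ complex_norm0_eq0.

Lemma carrier_normE (x : B') : `|x| = (N x)%:C. Proof. by []. Qed.

Lemma carrier_ballE (x y : B') (r : R) : ball x r%:C y = (N (x - y) < r).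
Proof. by rewrite -ball_normE /ball_ /= carrier_normE ltcR. Qed.

(** A Cauchy filter contains a ball of radius 1 / (k + 1) for every k; the
    centres form a Cauchy sequence, whose limit is a limit of the filter. *)
Fact cstar_carrier_complete (F : set_system B') :
  ProperFilter F -> cauchy F -> cvg F.
Proof.
move=> FF /cauchyP F_cauchy.
have /choice[x Fx] : forall k : nat, exists x : B', F (ball x (k.+1%:R^-1)%:C).
  by move=> k; apply: F_cauchy; rewrite ltcR invr_gt0.
have x_cauchy : cauchy_for N x.
  move=> eps eps0; have eps2 : 0 < eps / 2 by rewrite divr_gt0.
  have [K hK] := inv_nat_small eps2.
  exists K => m n Km Kn.
  have [y [/=]] := filter_ex (filterI (Fx m) (Fx n)).
  rewrite !carrier_ballE => my ny.
  have := cnorm_triangle hN y (x m) (x n); rewrite (cnormB hN y (x n)).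
  by have := lt_le_trans my (hK m Km); have := lt_le_trans ny (hK n Kn); lra.
have [l xl] := N_complete x_cauchy.
apply/cvg_ex; exists (l : B') => /=; apply/cvg_ballP => eps eps0.
have [r r0 epsE] : exists2 r : R, 0 < r & eps = r%:C.
  have /complex_realP[r rE] := gtr0_real eps0.
  by exists r => //; rewrite -ltcR -rE.
have r2 : 0 < r / 2 by rewrite divr_gt0.
have [K hK] := inv_nat_small r2.
have /cvgr0Pnorm_lt/(_ _ r2)[L _ hL] := xl.
pose k := maxn K L.
apply: filterS (Fx k) => y; rewrite epsE !carrier_ballE => ky.
have := hL k (leq_maxr _ _); rewrite /= ger0_norm ?(cnorm_ge0 hN) // => kl.
have := cnorm_triangle hN (x k) l y; rewrite (cnormB hN l (x k)).
by have := lt_le_trans ky (hK k (leq_maxl _ _)); lra.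
Qed.

HB.instance Definition _ :=
  Uniform_isComplete.Build B' cstar_carrier_complete.

Fact carrier_norm_smul (x y : B') : `|x ** y| <= `|x| * `|y|.
Proof. by rewrite !carrier_normE -rmorphM lecR; exact: (cnormM hN). Qed.

Fact carrier_norm_star_smul (x : B') : `|star x ** x| = `|x| ^+ 2.
Proof.
by rewrite !carrier_normE -rmorphXn; congr (_%:C); exact: (cnorm_star_mul hN).
Qed.

HB.instance Definition _ := StarAlgebra_isCStar.Build R[i] B'
  carrier_norm_smul carrier_norm_star_smul.

End CompleteCStarNorm.

Section Representability.
Variables (R : realType) (A : unitalStarAlgType R[i]).

(** A representation preserves products and adjoints, so the C*-identity of
    the target pulls back along it.  Conversely the C*-algebra built from a
    norm on A is the completion of A. *)
Lemma cstar_representableP :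
  cstar_representable A <-> exists N : A -> R, cstar_norm N.
Proof.
split.
- move=> [B [S [phi [_ phi_hom [_ inj _]]]]]; have [_ mul st] := phi_hom.
  have normE (x : B) : (complex.Re `|x|)%:C = `|x|.
    by rewrite RRe_real ?normr_real.
  exists (fun a => complex.Re `|phi a|); split.
  + move=> x /(congr1 (real_complex R)); rewrite normE => /eqP.
    rewrite normr_eq0 => /eqP x0; apply: inj; rewrite ?inE //.
    by rewrite star_hom0.
  + by move=> x y; rewrite -lecR rmorphD /= !normE star_homD // ler_normD.
  + move=> c x; apply: complexI.
    by rewrite rmorphM /= modulusE !normE star_homZ // normrZ.
  + by move=> x y; rewrite -lecR rmorphM /= !normE mul ler_norm_smul.
  + move=> x; apply: complexI.
    by rewrite rmorphXn /= !normE mul st norm_star_smul.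
move=> [N hN].
have hL := limit_norm_is_cstar hN; have cL := @limit_norm_complete _ _ _ hN.
pose phi : A -> cstar_carrier hL cL := @embed _ _ _ hN.
have hom : star_homomorphism phi by exact: embed_is_hom.
exists (cstar_carrier hL cL), (range phi), phi; split => //.
  exact: star_hom_range_subalgebra.
apply: inj_bij => x y _ _ xy.
apply/eqP; rewrite -subr_eq0; apply/eqP/(cnorm_eq0 hN).
rewrite -(limit_norm_embed hN) -[embed hN _]/(phi _) star_homB // xy subrr.
exact: (cnorm0 hL).
Qed.

End Representability.

(** * The cone of sums of elements x^* x *)

Section PositiveCone.
Variables (R : realType) (A : unitalStarAlgType R[i]).
Local Notation e := (sone : A).
Local Notation pos_cone := (@pos_cone R A).
Implicit Types (a b x y : A) (r s t : R).

Lemma pos_cone_star_mul x : pos_cone (star x ** x).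
Proof. by exists 1%N, (fun=> x); split=> //; rewrite big_ord1. Qed.

Lemma pos_cone_square x : self_adjoint x -> pos_cone (x ** x).
Proof. by move=> sx; rewrite -{1}sx; exact: pos_cone_star_mul. Qed.

Lemma pos_cone0 : pos_cone 0.
Proof. by rewrite -(smulx0 (star 0)); exact: pos_cone_star_mul. Qed.

Lemma pos_coneD a b : pos_cone a -> pos_cone b -> pos_cone (a + b).
Proof.
move=> [n [x [n1 ->]]] [m [y [m1 ->]]].
exists (n + m)%N, (fun j =>
  match fintype.split j with inl k => x k | inr k => y k end).
split; first exact: leq_trans n1 (leq_addr _ _).
rewrite big_split_ord; congr (_ + _); apply: eq_bigr => j _.
  by rewrite (unsplitK (inl j : 'I_n + 'I_m)).
by rewrite (unsplitK (inr j : 'I_n + 'I_m)).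
Qed.

Lemma pos_coneZ r a : 0 <= r -> pos_cone a -> pos_cone (r%:C *: a).
Proof.
move=> r0 [n [x [n1 ->]]]; exists n, (fun j => (Num.sqrt r)%:C *: x j).
split=> //; rewrite scaler_sumr; apply: eq_bigr => j _.
rewrite starZ conj_real smulZl smulZr scalerA -rmorphM /=.
by rewrite -expr2 sqr_sqrtr.
Qed.

Lemma pos_coneZV r a : 0 < r -> pos_cone (r%:C *: a) -> pos_cone a.
Proof.
move=> r0 /(pos_coneZ (r := r^-1)); rewrite invr_ge0 ltW // => /(_ isT).
by rewrite scalerA -rmorphM /= mulVf ?gt_eqF // rmorph1 scale1r.
Qed.

Lemma pos_cone_conj y a : pos_cone a -> pos_cone (star y ** a ** y).
Proof.
move=> [n [x [n1 ->]]]; exists n, (fun j => x j ** y); split=> //.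
rewrite smul_sumr smul_suml; apply: eq_bigr => j _.
by rewrite starM !smulA.
Qed.

Lemma pos_cone_one r : 0 <= r -> pos_cone (r%:C *: e).
Proof.
move=> r0; apply: pos_coneZ => //; rewrite -(smul1x e).
exact/pos_cone_square/star_one.
Qed.

Lemma parallelogram x y :
  star (x + y) ** (x + y) + star (x - y) ** (x - y) =
  2%:C *: (star x ** x + star y ** y).
Proof. by rewrite !starE !smulE; linear_identity. Qed.

(** For r > 0 this plays the role of the inequality of norms N x <= r: in a
    C*-algebra x^* x <= r^2 e holds exactly when the norm of x is at most r. *)
Definition dominated r x := pos_cone ((r ^+ 2)%:C *: e - star x ** x).

Lemma dominated_le r s x : 0 <= r -> r <= s -> dominated r x -> dominated s x.
Proof.
move=> r0 rs rx; rewrite /dominated.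
have -> : (s ^+ 2)%:C *: e - star x ** x =
    (s ^+ 2 - r ^+ 2)%:C *: e + ((r ^+ 2)%:C *: e - star x ** x).
  by linear_identity.
apply: pos_coneD => //; apply: pos_cone_one; nra.
Qed.

(** 2 r (r e - x) = (r e - x)^2 + (r^2 e - x^2). *)
Lemma dominated_sa r x : 0 < r -> self_adjoint x -> dominated r x ->
  pos_cone (r%:C *: e - x).
Proof.
move=> r0 sx rx; apply: (pos_coneZV (r := 2 * r)); first by nra.
have -> : (2 * r)%:C *: (r%:C *: e - x) =
    (r%:C *: e - x) ** (r%:C *: e - x) + ((r ^+ 2)%:C *: e - star x ** x).
  rewrite sx !(smulE, scalerBr, scalerDr) !smul1x smulx1; linear_identity.
apply: pos_coneD => //; apply: pos_cone_square.
by rewrite /self_adjoint !starE star_one conj_real sx.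
Qed.

(** The elements u = r e - a and v = r e + a commute and belong to the cone,
    and r^2 e - a^2 = u v.  Products of cone elements need not stay in the
    cone, but u v u and v u v do, and u v u + v u v = u v (u + v) = 2 r u v. *)
Lemma dominated_bounded_sa a : self_adjoint a -> bounded_sa a ->
  exists2 r, 0 < r & dominated r a.
Proof.
move=> sa [al [al0 le_a ge_a]].
(* The bound al may be 0, while the identity is divided by 2 r. *)
pose r := al + 1.
have r0 : 0 < r by rewrite ltr_wpDl.
pose u := r%:C *: e - a; pose v := r%:C *: e + a.
have u0 : pos_cone u.
  have -> : u = e + (al%:C *: e - a) by rewrite /u /r; linear_identity.
  by apply: pos_coneD => //; rewrite -[e]scale1r; exact: pos_cone_one.
have v0 : pos_cone v.
  have -> : v = e + (a - - (al%:C *: e)) by rewrite /v /r; linear_identity.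
  by apply: pos_coneD => //; rewrite -[e]scale1r; exact: pos_cone_one.
have su : star u = u by rewrite /u !starE star_one conj_real sa.
have sv : star v = v by rewrite /v !starE star_one conj_real sa.
exists r => //; apply: (pos_coneZV (r := 2 * r)); first by nra.
have uv : u ** v = (r ^+ 2)%:C *: e - star a ** a.
  rewrite /u /v sa !(smulE, scalerBr, scalerDr) !smul1x smulx1.
  linear_identity.
have vu : v ** u = u ** v.
  rewrite /u /v !(smulE, scalerBr, scalerDr) !smul1x !smulx1.
  linear_identity.
have -> : (2 * r)%:C *: ((r ^+ 2)%:C *: e - star a ** a) =
    star u ** v ** u + star v ** u ** v.
  rewrite su sv vu -smulDr -uv.
  have -> : u + v = (2 * r)%:C *: e by rewrite /u /v; linear_identity.
  by rewrite smulZr smulx1.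
by apply: pos_coneD; exact: pos_cone_conj.
Qed.

(** The cross terms x^* y + y^* x are controlled by the square of
    s x - r y, the combination that vanishes when the triangle inequality is
    sharp. *)
Lemma dominatedD r s x y : 0 < r -> 0 < s -> dominated r x -> dominated s y ->
  dominated (r + s) (x + y).
Proof.
move=> r0 s0 rx sy; apply: (pos_coneZV (r := r * s)); first by nra.
pose z := s%:C *: x - r%:C *: y.
have -> : (r * s)%:C *: (((r + s) ^+ 2)%:C *: e - star (x + y) ** (x + y)) =
    star z ** z + ((s * (r + s))%:C *: ((r ^+ 2)%:C *: e - star x ** x) +
    (r * (r + s))%:C *: ((s ^+ 2)%:C *: e - star y ** y)).
  by rewrite /z !starE !conj_real !(smulE, scalerBr, scalerDr); linear_identity.
apply: pos_coneD; first exact: pos_cone_star_mul.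
by apply: pos_coneD; apply: pos_coneZ => //; nra.
Qed.

Lemma conj_mul_self (c : R[i]) : Num.conj c * c = (modulus c ^+ 2)%:C.
Proof. by rewrite mulrC -normCK rmorphXn /= modulusE. Qed.

Lemma dominatedZ c r x : dominated r x -> dominated (modulus c * r) (c *: x).
Proof.
move=> rx; rewrite /dominated.
have -> : ((modulus c * r) ^+ 2)%:C *: e - star (c *: x) ** (c *: x) =
    (modulus c ^+ 2)%:C *: ((r ^+ 2)%:C *: e - star x ** x).
  rewrite starZ smulZl smulZr scalerA conj_mul_self; linear_identity.
by apply: pos_coneZ => //; exact: sqr_ge0.
Qed.

Lemma dominatedM r s x y : dominated r x -> dominated s y ->
  dominated (r * s) (x ** y).
Proof.
move=> rx sy; rewrite /dominated.
have -> : ((r * s) ^+ 2)%:C *: e - star (x ** y) ** (x ** y) =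
    star y ** ((r ^+ 2)%:C *: e - star x ** x) ** y +
    (r ^+ 2)%:C *: ((s ^+ 2)%:C *: e - star y ** y).
  by rewrite starM !smulE smulx1 !smulA; linear_identity.
apply: pos_coneD; first exact: pos_cone_conj.
by apply: pos_coneZ => //; exact: sqr_ge0.
Qed.

(** With b = x x^*, the hypothesis gives b^2 = x (x^* x) x^* <= r^2 b, and
    r^2 (r^2 e - b) = (r^2 e - b)^2 + (r^2 b - b^2). *)
Lemma dominated_star r x : 0 < r -> dominated r x -> dominated r (star x).
Proof.
move=> r0 rx; rewrite /dominated starK.
pose b := x ** star x; pose u := (r ^+ 2)%:C *: e - b.
have su : self_adjoint u.
  by rewrite /self_adjoint /u /b !starE conj_real star_one starK.
apply: (pos_coneZV (r := r ^+ 2)); first exact: exprn_gt0.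
have -> : (r ^+ 2)%:C *: ((r ^+ 2)%:C *: e - b) =
    u ** u + star (star x) ** ((r ^+ 2)%:C *: e - star x ** x) ** star x.
  rewrite starK /u /b !(smulE, scalerBr, scalerDr) !smul1x !smulx1 !smulA.
  by linear_identity.
by apply: pos_coneD; [exact: pos_cone_square | exact: pos_cone_conj].
Qed.

Lemma dominated_star_mul r x : 0 < r ->
  dominated (r ^+ 2) (star x ** x) -> dominated r x.
Proof.
move=> r0; apply: dominated_sa; first exact: exprn_gt0.
by rewrite /self_adjoint starM starK.
Qed.

Lemma dominated_cartesian r s a b : self_adjoint a -> self_adjoint b ->
  dominated r a -> dominated s b ->
  dominated (Num.sqrt (2 * (r ^+ 2 + s ^+ 2))) (a + 'i *: b).
Proof.
move=> sa sb ra rb; rewrite /dominated sqr_sqrtr; last first.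
  by rewrite mulr_ge0 // addr_ge0 // sqr_ge0.
have ib : star ('i *: b) ** ('i *: b) = star b ** b.
  by rewrite starZ smulZl smulZr scalerA conj_mul_self modulusi expr1n scale1r.
have -> : star (a + 'i *: b) ** (a + 'i *: b) =
    2%:C *: (star a ** a + star b ** b) - star (a - 'i *: b) ** (a - 'i *: b).
  by rewrite -ib -parallelogram addrK.
have -> : (2 * (r ^+ 2 + s ^+ 2))%:C *: e -
    (2%:C *: (star a ** a + star b ** b) -
     star (a - 'i *: b) ** (a - 'i *: b)) =
    2%:C *: (((r ^+ 2)%:C *: e - star a ** a) +
             ((s ^+ 2)%:C *: e - star b ** b)) +
    star (a - 'i *: b) ** (a - 'i *: b) by linear_identity.
apply: pos_coneD; last exact: pos_cone_star_mul.
by apply: pos_coneZ => //; exact: pos_coneD.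
Qed.

Lemma dominated_bounded x : bounded_elt x -> exists2 r, 0 < r & dominated r x.
Proof.
move=> [a [b [sa sb -> /(dominated_bounded_sa sa)[r r0 ra] bb]]].
have [s s0 sb'] := dominated_bounded_sa sb bb.
exists (Num.sqrt (2 * (r ^+ 2 + s ^+ 2))); last exact: dominated_cartesian.
by rewrite sqrtr_gt0 mulr_gt0 // addr_gt0 // exprn_gt0.
Qed.

(** A *-endomorphism need not fix e, but f e is a projection, so that
    e - f e = (e - f e)^* (e - f e) belongs to the cone. *)
Lemma dominated_hom (f : A -> A) r x : star_homomorphism f ->
  dominated r x -> dominated r (f x).
Proof.
move=> f_hom [n [y [n1 yE]]]; have [_ mul st] := f_hom.
have se : self_adjoint (e - f e).
  by rewrite /self_adjoint starD starN -st star_one.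
have pe : pos_cone (e - f e).
  have -> : e - f e = (e - f e) ** (e - f e).
    rewrite !smulE !smul1x smulx1 -mul smul1x; linear_identity.
  exact: pos_cone_square.
rewrite /dominated (_ : (r ^+ 2)%:C *: e - star (f x) ** f x =
    (r ^+ 2)%:C *: (e - f e) + f ((r ^+ 2)%:C *: e - star x ** x)); last first.
  rewrite (star_homB f_hom) (star_homZ f_hom) mul st; linear_identity.
apply: pos_coneD; first by apply: pos_coneZ => //; exact: sqr_ge0.
rewrite yE (big_morph f (star_homD f_hom) (star_hom0 f_hom)).
exists n, (f \o y); split=> //.
by apply: eq_bigr => j _; rewrite mul st.
Qed.

End PositiveCone.

(** * The order seminorm *)

Section OrderSeminorm.
Variables (R : realType) (A : unitalStarAlgType R[i]).
Hypothesis A_bounded : bounded_star_algebra A.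
Local Notation e := (sone : A).
Implicit Types (x y : A) (r s t : R).

Definition order_seminorm x : R := inf [set r | 0 < r /\ dominated r x].
Local Notation N := order_seminorm.

Lemma dominating_set_has_inf x : has_inf [set r | 0 < r /\ dominated r x].
Proof.
split; last by exists 0 => r [r0 _]; exact: ltW.
by have [r r0 rx] := dominated_bounded (A_bounded x); exists r.
Qed.

Lemma order_seminorm_le r x : 0 < r -> dominated r x -> N x <= r.
Proof.
by move=> r0 rx; apply: inf_lbound => //; exact: (dominating_set_has_inf x).2.
Qed.

Lemma order_seminorm_ge0 x : 0 <= N x.
Proof.
apply: lb_le_inf; first exact: (dominating_set_has_inf x).1.
by move=> r [r0 _]; exact: ltW.
Qed.

Lemma order_seminorm_lt r x : N x < r -> dominated r x.
Proof.
move=> /(inf_lt (dominating_set_has_inf x).1)[s [s0 sx] sr].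
by apply: dominated_le sx; exact: ltW.
Qed.

Lemma order_seminorm_gt0 r x : N x < r -> 0 < r.
Proof. exact: le_lt_trans (order_seminorm_ge0 x). Qed.

Lemma order_seminormZ_le c x : N (c *: x) <= modulus c * N x.
Proof.
have [->|c0] := eqVneq c 0.
  rewrite scale0r modulus0 mul0r; apply/ler_addgt0Pr => eps eps0.
  rewrite add0r; apply: order_seminorm_le => //.
  rewrite /dominated smulx0 subr0.
  by apply: pos_cone_one; exact: sqr_ge0.
have m0 : 0 < modulus c.
  by rewrite -ltcR modulusE normr_gt0.
rewrite mulrC; apply: le_mul_of_gt => [|r xr]; first exact: ltW.
rewrite mulrC; apply: order_seminorm_le.
  by rewrite mulr_gt0 // (order_seminorm_gt0 xr).
exact/dominatedZ/order_seminorm_lt.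
Qed.

Lemma order_seminormZ c x : N (c *: x) = modulus c * N x.
Proof.
apply/eqP; rewrite eq_le order_seminormZ_le /=.
have [->|c0] := eqVneq c 0; first by rewrite modulus0 mul0r order_seminorm_ge0.
have m0 : 0 < modulus c by rewrite -ltcR modulusE normr_gt0.
rewrite -ler_pdivlMl //.
have := order_seminormZ_le c^-1 (c *: x).
rewrite scalerA mulVf // scale1r; congr (_ <= _ * _).
by apply: complexI; rewrite modulusE fmorphV /= modulusE normfV.
Qed.

Lemma order_seminormD x y : N (x + y) <= N x + N y.
Proof.
apply/ler_addgt0Pr => eps eps0; have eps2 : 0 < eps / 2 by rewrite divr_gt0.
have xr : N x < N x + eps / 2 by rewrite ltrDl.
have yr : N y < N y + eps / 2 by rewrite ltrDl.
have -> : N x + N y + eps = (N x + eps / 2) + (N y + eps / 2) by field.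
have x0 := order_seminorm_gt0 xr; have y0 := order_seminorm_gt0 yr.
apply: order_seminorm_le; first exact: addr_gt0.
by apply: dominatedD => //; exact: order_seminorm_lt.
Qed.

Lemma order_seminormM x y : N (x ** y) <= N x * N y.
Proof.
apply: le_mul_of_gt => [|r xr]; first exact: order_seminorm_ge0.
have r0 := order_seminorm_gt0 xr.
rewrite mulrC; apply: le_mul_of_gt => [|s ys]; first exact: ltW.
have s0 := order_seminorm_gt0 ys; rewrite mulrC.
apply: order_seminorm_le; first exact: mulr_gt0.
by apply: dominatedM; exact: order_seminorm_lt.
Qed.

Lemma order_seminorm_star_le x : N (star x) <= N x.
Proof.
rewrite -[N x]mulr1; apply: le_mul_of_gt => // r xr; rewrite mulr1.
have r0 := order_seminorm_gt0 xr; apply: order_seminorm_le => //.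
exact/dominated_star/order_seminorm_lt.
Qed.

Lemma order_seminorm_star_mul x : N (star x ** x) = N x ^+ 2.
Proof.
apply/eqP; rewrite eq_le; apply/andP; split.
  apply: le_trans (order_seminormM _ _) _; rewrite expr2.
  by rewrite ler_wpM2r ?order_seminorm_ge0 ?order_seminorm_star_le.
rewrite -[N (star x ** x)]mulr1; apply: le_mul_of_gt => // r xr; rewrite mulr1.
have r0 := order_seminorm_gt0 xr.
have sr0 : 0 < Num.sqrt r by rewrite sqrtr_gt0.
have xs : N x <= Num.sqrt r.
  apply: order_seminorm_le => //; apply: dominated_star_mul => //.
  by rewrite (sqr_sqrtr (ltW r0)); exact: order_seminorm_lt.
by rewrite -[leRHS](sqr_sqrtr (ltW r0)) ler_pXn2r ?nnegrE ?order_seminorm_ge0.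
Qed.

Definition seminorm_kernel : set A := [set x | N x = 0].

Lemma seminorm_kernelP x : N x <= 0 -> seminorm_kernel x.
Proof. by move=> x0; apply/eqP; rewrite eq_le x0 order_seminorm_ge0. Qed.

Lemma seminorm_kernel_ideal : star_ideal seminorm_kernel.
Proof.
split.
- apply: seminorm_kernelP.
  by rewrite -(scale0r 0) order_seminormZ modulus0 mul0r.
- move=> c x y x0 y0; apply: seminorm_kernelP.
  apply: le_trans (order_seminormD _ _) _.
  by rewrite order_seminormZ x0 y0 mulr0 addr0.
- move=> a x x0; split; apply: seminorm_kernelP;
    apply: le_trans (order_seminormM _ _) _.
    by rewrite x0 mulr0.
  by rewrite x0 mul0r.
- move=> x x0; apply: seminorm_kernelP.
  by apply: le_trans (order_seminorm_star_le _) _; rewrite x0.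
Qed.

Lemma seminorm_kernel_endo : endomorphically_closed seminorm_kernel.
Proof.
move=> f f_hom _ [x x0 <-]; apply: seminorm_kernelP.
apply/ler_addgt0Pr => eps eps0; rewrite add0r; apply: order_seminorm_le => //.
by apply: dominated_hom => //; apply: order_seminorm_lt; rewrite x0.
Qed.

(** A term of a sum y of elements x x^* is at most y, and y <= eps^2 e for
    every eps > 0 because y is self-adjoint of seminorm 0. *)
Lemma seminorm_kernel_sqrt : square_root_closed seminorm_kernel.
Proof.
move=> n x; set y := \sum_(j < n) _ => y0 j.
have sy : self_adjoint y.
  rewrite /self_adjoint /y star_sum; apply: eq_bigr => k _.
  by rewrite starM starK.
suff sx0 : N (star (x j)) <= 0.
  apply: seminorm_kernelP; rewrite -[x j]starK.
  exact: le_trans (order_seminorm_star_le _) sx0.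
apply/ler_addgt0Pr => eps eps0; rewrite add0r; apply: order_seminorm_le => //.
rewrite /dominated starK.
have y_le : pos_cone ((eps ^+ 2)%:C *: (sone : A) - y).
  apply: dominated_sa => //; first exact: exprn_gt0.
  by apply: order_seminorm_lt; rewrite y0 exprn_gt0.
have -> : (eps ^+ 2)%:C *: e - x j ** star (x j) =
    ((eps ^+ 2)%:C *: e - y) + \sum_(k < n | k != j) x k ** star (x k).
  by rewrite /y (bigD1 j) //=; linear_identity.
apply: pos_coneD => //; rewrite big_mkcond.
elim/big_ind: _ => [|a b|k _]; [exact: pos_cone0 | exact: pos_coneD |].
case: ifP => _; last exact: pos_cone0.
by rewrite -{1}[x k]starK; exact: pos_cone_star_mul.
Qed.

(** If e has seminorm 0, then (1/4) e - e belongs to the cone. *)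
Lemma seminorm_kernel_full : seminorm_kernel = [set: A] -> pos_cone (- e).
Proof.
move=> kT; have e0 : N e = 0 by rewrite -[_ = _]/(seminorm_kernel e) kT.
have : dominated 2^-1 e by apply: order_seminorm_lt; rewrite e0 invr_gt0.
rewrite /dominated star_one smul1x => h.
apply: (pos_coneZV (r := 3 / 4)); first by lra.
rewrite (_ : _ *: - e = (2^-1 ^+ 2)%:C *: e - e) //.
have -> : 3 / 4 = 1 - 2^-1 ^+ 2 :> R by field.
linear_identity.
Qed.

End OrderSeminorm.

(** If - e is the sum of the (x k)^* (x k), the matrix M whose first column is
    (e, x 0, x 1, ...) and whose other columns vanish satisfies M^* M = 0. *)
Lemma completely_positive_proper (R : realType) (A : unitalStarAlgType R[i]) :
  completely_positive A -> pos_cone (- sone : A) -> (sone : A) = 0.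
Proof.
move=> Apos [n [x [_ xE]]].
pose col (i : 'I_n.+1) : A := if unlift ord0 i is Some k then x k else sone.
have col0 : col ord0 = sone by rewrite /col unlift_none.
have colS k : col (lift ord0 k) = x k by rewrite /col liftK.
pose M : star_matrix A n.+1 := \matrix_(i, j) if j == ord0 then col i else 0.
have MM : star M ** M = 0.
  apply/matrixP => i j; rewrite !mxE.
  have [->|j0] := eqVneq j ord0; last first.
    by rewrite big1 // => k _; rewrite !mxE (negbTE j0) smulx0.
  have [->|i0] := eqVneq i ord0; last first.
    by rewrite big1 // => k _; rewrite !mxE (negbTE i0) star0 smul0x.
  rewrite big_ord_recl !mxE eqxx col0 star_one smul1x.
  rewrite (eq_bigr (fun k => star (x k) ** x k)) => [|k _].
    by rewrite -xE subrr.
  by rewrite !mxE eqxx colS.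
have /matrixP/(_ ord0 ord0) := Apos n.+1 isT M MM.
by rewrite !mxE eqxx col0.
Qed.

(** The positivity of x^* x relies on square roots, which exist only after
    completion; the vanishing of a sum is then read off in A. *)
Lemma cstar_norm_completely_positive (R : realType)
  (A : unitalStarAlgType R[i]) (N : A -> R) :
  cstar_norm N -> completely_positive A.
Proof.
move=> hN n _ M MM; apply/matrixP => i j.
have hL := limit_norm_is_cstar hN; have cL := @limit_norm_complete _ _ _ hN.
have hom := embed_is_hom hN; have [_ mul st] := hom.
rewrite mxE; apply: (cnorm_eq0 hN); rewrite -(limit_norm_embed hN).
suff -> : embed hN (M i j) = 0 by exact: cnorm0.
apply: (sum_star_mul_eq0 hL cL (x := fun k => embed hN (M k j))).
move/matrixP/(_ j j) : MM; rewrite !mxE => /(congr1 (embed hN)).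
rewrite (big_morph _ (star_homD hom) (star_hom0 hom)) (star_hom0 hom) => h.
by apply: etrans h; apply: eq_bigr => k _; rewrite mxE mul st.
Qed.

Theorem corollary3 (R : realType) (A : unitalStarAlgType R[i])
    (A_bounded : bounded_star_algebra A)
    (A_simple : forall J : set A, star_ideal J -> endomorphically_closed J ->
       square_root_closed J -> trivial_ideal J) :
  cstar_representable A <-> completely_positive A.
Proof.
split=> [/cstar_representableP[N hN]|A_pos].
  exact: cstar_norm_completely_positive hN.
have ker0 (x : A) : seminorm_kernel x -> x = 0.
  have [k0|kT] := A_simple _ (seminorm_kernel_ideal A_bounded)
    (seminorm_kernel_endo A_bounded) (seminorm_kernel_sqrt A_bounded).
    by rewrite k0.
  move=> _; have := completely_positive_proper A_pos
    (seminorm_kernel_full A_bounded kT).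
  by move=> e0; rewrite -[x]smul1x e0 smul0x.
apply/cstar_representableP; exists (@order_seminorm R A); split.
- exact: ker0.
- exact: order_seminormD.
- exact: order_seminormZ.
- exact: order_seminormM.
- exact: order_seminorm_star_mul.
Qed.
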